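(* Let $k\ge3$, $\ell\ge k-1$ be integers and $f\in L^2(\Omega)$. Let $(\boldsymbol\sigma_h,u_h)\in\boldsymbol\Sigma_h\times\mathcal Q_h$ be the solution of the mixed finite element method $$(\boldsymbol\sigma_h,\boldsymbol\tau_h)+(\operatorname{div}\operatorname{div}\boldsymbol\tau_h,u_h)=0\ \ \forall\boldsymbol\tau_h\in\boldsymbol\Sigma_h,\qquad(\operatorname{div}\operatorname{div}\boldsymbol\sigma_h,v_h)=(f,v_h)\ \ \forall v_h\in\mathcal Q_h.$$ Let $(\widetilde{\boldsymbol\sigma}_h,\widetilde u_h,\lambda_h)\in\widetilde{\boldsymbol\Sigma}_h\times\mathcal Q_h\times\Lambda_h$ satisfy the partially hybridized method $$(\widetilde{\boldsymbol\sigma}_h,\boldsymbol\tau_h)+b_h(\boldsymbol\tau_h,\widetilde u_h,\lambda_h)=0\ \ \forall\boldsymbol\tau_h\in\widetilde{\boldsymbol\Sigma}_h,\qquad b_h(\widetilde{\boldsymbol\sigma}_h,v_h,\mu_h)=(f,v_h)\ \ \forall v_h\in\mathcal Q_h,\ \mu_h\in\Lambda_h,$$ where $$b_h(\boldsymbol\tau_h,v_h,\mu_h)=\sum_{K\in\mathcal T_h}(\operatorname{div}\operatorname{div}\boldsymbol\tau_h,v_h)_K-\sum_{K\in\mathcal T_h}(\partial_t(\boldsymbol t^{\intercal}\boldsymbol\tau_h\boldsymbol n)+\boldsymbol n^{\intercal}\operatorname{div}\boldsymbol\tau_h,\mu_h)_{\partial K}.$$ Then $\widetilde{\boldsymbol\sigma}_h=\boldsymbol\sigma_h$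 and $\widetilde u_h=u_h$.
   Context: $\Omega\subset\mathbb R^2$ is a bounded (simply connected) polygon, $\mathcal T_h$ a conforming triangulation with edges $\mathcal E_h$ and interior edges $\mathcal E_h^i$. $\mathbb S$: symmetric real $2\times2$ matrices; $\operatorname{div}$ of a matrix is row-wise; $\mathbb P_m$: polynomials of total degree $\le m$. In $b_h$, $\boldsymbol n=(n_1,n_2)^{\intercal}$ is the unit outward normal on $\partial K$, $\boldsymbol t=(-n_2,n_1)^{\intercal}$, and the $\partial K$ inner product is the sum over the edges of $K$. $\boldsymbol\Sigma_{\ell,k}(K)=\operatorname{sym}\operatorname{curl}\mathbb P_{\ell+1}(K;\mathbb R^2)\oplus\boldsymbol x\boldsymbol x^{\intercal}\mathbb P_{k-2}(K)$, where $\operatorname{curl}\phi=(\partial_{x_2}\phi,-\partial_{x_1}\phi)^{\intercal}$ is applied row-wise to vectors, $\operatorname{sym}A=(A+A^{\intercal})/2$, and $\boldsymbol x$ has its origin at a point of $K$. Consider the quantities: (S1) $\boldsymbol\tau(\delta)$ at vertices $\delta$; (S2) $(\boldsymbol n^{\intercal}\boldsymbol\tau\boldsymbol n,q)_e$, $q\in\mathbb P_{\ell-2}(e)$, on edges $e$; (S3) $(\partial_{t_e}(\boldsymbol t^{\intercal}\boldsymbol\tau\boldsymbol n)+\boldsymbol n_e^{\intercal}\operatorname{div}\boldsymbol\tau,q)_e$, $q\in\mathbb P_{\ell-1}(e)$, on edges $e$, with $\boldsymbol n_e=(n_1,n_2)^{\intercal}$ a fixed unit normal of $e$ and $\boldsymbol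 t_e=(-n_2,n_1)^{\intercal}$. Single-valued means equal when computed from all elements sharing the vertex or edge. $\boldsymbol\Sigma_h$ (respectively $\widetilde{\boldsymbol\Sigma}_h$) is the set of $\boldsymbol\tau_h\in\boldsymbol L^2(\Omega;\mathbb S)$ with $\boldsymbol\tau_h|_K\in\boldsymbol\Sigma_{\ell,k}(K)$ for all $K\in\mathcal T_h$ and with (S1)-(S3) (respectively only (S1)-(S2)) single-valued. $\mathcal Q_h=\{q_h\in L^2(\Omega):q_h|_K\in\mathbb P_{k-2}(K)\ \forall K\}$. $\Lambda_h=\{\mu_h\in L^2(\mathcal E_h):\mu_h|_e\in\mathbb P_{\ell-1}(e)\ \forall e\in\mathcal E_h^i,\ \mu_h|_e=0\ \forall e\in\mathcal E_h\setminus\mathcal E_h^i\}$. One has $\operatorname{div}\operatorname{div}\boldsymbol\tau_h\in L^2(\Omega)$ for $\boldsymbol\tau_h\in\boldsymbol\Sigma_h$. *)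

(* Defs.v *)
From HB Require Import structures.
From mathcomp Require Import all_boot all_order all_algebra.
From mathcomp Require mpoly.
From mathcomp Require Import all_classical all_reals all_analysis.
(* A full import of mpoly clashes with the notations of analysis. *)
Export (canonicals, coercions) mpoly.

Set Implicit Arguments.
Unset Strict Implicit.
Unset Printing Implicit Defensive.

Import Order.TTheory GRing.Theory Num.Theory.
Import numFieldNormedType.Exports.

Local Open Scope classical_set_scope.
Local Open Scope ring_scope.

Notation poly2 R := (mpoly.mpoly 2 R).

Section Plane.
Context {R : realType}.
Implicit Types (x a b : R * R) (p q : poly2 R) (tau : 'M[poly2 R]_2).

Definition mu2 := (@lebesgue_measure R \x @lebesgue_measure R)%E.

Definition vec x : 'cV[R]_2 := \col_i (if i == ord0 then x.1 else x.2).

Definition dotv (u v : 'cV[R]_2) : R := \sum_i u i 0 * v i 0.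

Definition seg a b (s : R) : R * R :=
  ((1 - s) * a.1 + s * b.1, (1 - s) * a.2 + s * b.2).

Definition peval p x : R := mpoly.meval (fun i => vec x i 0) p.

(* mpoly.msize is one more than the total degree, and 0 at the zero
   polynomial. *)
Definition deg_le (n : nat) p : Prop := (mpoly.msize p <= n.+1)%N.

Definition deg1_le (n : nat) (q : {poly R}) : Prop := (size q <= n.+1)%N.

Definition cst (u : 'cV[R]_2) : 'cV[poly2 R]_2 := map_mx (@mpoly.mpolyC 2 R) u.

Definition pd (i : 'I_2) p : poly2 R := mpoly.mderiv i p.

Definition dird (u : 'cV[R]_2) p : poly2 R := \sum_i u i 0 *: pd i p.

Definition curl p : 'rV[poly2 R]_2 :=
  \row_j (if j == ord0 then pd ord_max p else - pd ord0 p).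

Definition curlv (phi : 'cV[poly2 R]_2) : 'M[poly2 R]_2 :=
  \matrix_(i, j) curl (phi i 0) 0 j.

Definition sym tau : 'M[poly2 R]_2 :=
  \matrix_(i, j) ((2%:R^-1 : R) *: (tau i j + tau j i)).

Definition divv (w : 'cV[poly2 R]_2) : poly2 R := \sum_i pd i (w i 0).

Definition divm tau : 'cV[poly2 R]_2 := \col_i \sum_j pd j (tau i j).

Definition divdiv tau : poly2 R := divv (divm tau).

Definition bilin (u v : 'cV[R]_2) tau : poly2 R :=
  ((cst u)^T *m tau *m cst v) 0 0.

(* For n = (n1, n2), the tangent (-n2, n1). *)
Definition rot (n : 'cV[R]_2) : 'cV[R]_2 :=
  \col_i (if i == ord0 then - n ord_max 0 else n ord0 0).

(* d_t (t^T tau n) + n^T div tau, with t = rot n. *)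
Definition tr3 (n : 'cV[R]_2) tau : poly2 R :=
  dird (rot n) (bilin (rot n) n tau) + ((cst n)^T *m divm tau) 0 0.

(* Coordinates relative to the origin c. *)
Definition coordv (c : R * R) : 'cV[poly2 R]_2 :=
  \col_i (mpoly.mpolyX R (mpoly.mnm1 i) - mpoly.mpolyC 2 (vec c i 0)).

(* The sum is direct, so membership is existence of a decomposition. *)
Definition Sigma_loc (l k : nat) (c : R * R) tau : Prop :=
  exists (phi : 'cV[poly2 R]_2) (q : poly2 R),
    [/\ forall i, deg_le l.+1 (phi i 0), deg_le (k - 2) q &
        tau = sym (curlv phi) + q *: (coordv c *m (coordv c)^T)].

(* A bounded simply connected polygon: the bounded domain whose boundary is
   a simple closed polygonal line p_0 p_1 ... p_(n-1) p_0.  Simplicity is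
   injectivity of the parametrization by half-open sides; simple connectedness
   is then automatic (Jordan-Schoenflies). *)
Definition simple_polygon (Omega : set (R * R)) : Prop :=
  [/\ Omega !=set0, open Omega, bounded_set Omega, connected Omega &
      exists (n : nat) (p : 'I_n -> R * R),
        (forall i j s t, 0 <= s < 1 -> 0 <= t < 1 ->
           seg (p i) (p (ordS i)) s = seg (p j) (p (ordS j)) t ->
           i = j /\ s = t) /\
        closure Omega `\` Omega^° =
          [set x | exists i s, 0 <= s < 1 /\ x = seg (p i) (p (ordS i)) s] ].

Definition in_L2 (Omega : set (R * R)) (f : R * R -> R) : Prop :=
  measurable_fun Omega f /\
  (\int[mu2]_(x in Omega) ((f x) ^+ 2)%:E < +oo)%E.

End Plane.

(* Nodes and, for each element, its set of vertices. *)
Record mesh (R : realType) := Mesh {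
  nnode : nat;
  node : 'I_nnode -> R * R;
  elts : {set {set 'I_nnode}}
}.

Section MeshDefs.
Context {R : realType} (M : mesh R).
Local Notation I := 'I_(nnode M).
Local Notation elt := {set I}.
Local Notation edge := (I * I)%type.
Local Notation x_ := (@node R M).

Definition hull (A : {set I}) : set (R * R) :=
  [set x | exists w : I -> R,
     [/\ forall i, 0 <= w i, forall i, i \notin A -> w i = 0, \sum_i w i = 1 &
         x = (\sum_i w i * (x_ i).1, \sum_i w i * (x_ i).2)] ].

Definition affine_indep (A : {set I}) : Prop :=
  forall w : I -> R, (forall i, i \notin A -> w i = 0) -> \sum_i w i = 0 ->
    \sum_i w i * (x_ i).1 = 0 -> \sum_i w i * (x_ i).2 = 0 ->
    forall i, w i = 0.

(* Two distinct elements meet in the empty set, a common vertex or a common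
   edge: the hull of their common vertices. *)
Definition conforming_triangulation (Omega : set (R * R)) : Prop :=
  [/\ forall K, K \in elts M -> #|K| = 3%N /\ affine_indep K,
      forall K K', K \in elts M -> K' \in elts M ->
        hull K `&` hull K' = hull (K :&: K') &
      closure Omega = [set x | exists2 K, K \in elts M & hull K x] ].

(* An edge is the pair of its endpoints in increasing order; this order fixes
   the parametrization by [0, 1] and the normal of the edge. *)
Definition edge_of (e : edge) (K : elt) : bool :=
  [&& (e.1 < e.2)%N, e.1 \in K & e.2 \in K].

Definition is_edge (e : edge) : bool := [exists K in elts M, edge_of e K].

(* The interior edges are those shared by two elements. *)
Definition is_iedge (e : edge) : bool :=
  [exists K in elts M, [exists K' in elts M,
    [&& K != K', edge_of e K & edge_of e K']]].

Definition edge_vec (e : edge) : 'cV[R]_2 := vec (x_ e.2) - vec (x_ e.1).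

Definition edge_len (e : edge) : R := Num.sqrt (dotv (edge_vec e) (edge_vec e)).

(* n_e, such that rot n_e is the unit vector from x_ e.1 to x_ e.2. *)
Definition edge_normal (e : edge) : 'cV[R]_2 :=
  - rot ((edge_len e)^-1 *: edge_vec e).

(* The unit normal to e pointing out of K: the only nonzero term in the sum is
   that of the vertex opposite to e. *)
Definition out_normal (K : elt) (e : edge) : 'cV[R]_2 :=
  - Num.sg (\sum_(c in K) dotv (edge_normal e) (vec (x_ c) - vec (x_ e.1)))
    *: edge_normal e.

Definition intK (K : elt) (p : poly2 R) : R :=
  \int[mu2]_(x in hull K) peval p x.

(* (p, q)_e for q a polynomial in the parameter s in [0, 1] of e. *)
Definition edge_ip (e : edge) (p : poly2 R) (q : {poly R}) : R :=
  edge_len e * \int[@lebesgue_measure R]_(s in `[0, 1]%classic)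
                  (peval p (seg (x_ e.1) (x_ e.2) s) * q.[s]).

(* A square-integrable function on Omega which is polynomial on every element
   is represented by the family of its restrictions to the elements, and a
   piecewise polynomial function on the edges by the family of its expressions
   in the parameter of each edge.  Values outside elts M (resp. at pairs which
   are not edges) are irrelevant. *)
Definition bscal := elt -> poly2 R.
Definition btens := elt -> 'M[poly2 R]_2.
Definition eskel := edge -> {poly R}.

Implicit Types (tau sig : btens) (u v : bscal) (mu lam : eskel).

(* The L2 inner products on Omega, elementwise; divdiv is taken elementwise,
   which on the space Sigma_h is the distributional divdiv. *)
Definition ip_tens sig tau : R :=
  \sum_(K in elts M) intK K (\sum_i \sum_j sig K i j * tau K i j).

Definition ip_divdiv tau v : R :=
  \sum_(K in elts M) intK K (divdiv (tau K) * v K).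

Definition load (Omega : set (R * R)) (f : R * R -> R) v : R :=
  \sum_(K in elts M) \int[mu2]_(x in Omega `&` hull K) (f x * peval (v K) x).

Definition b_h tau v mu : R :=
  ip_divdiv tau v -
  \sum_(K in elts M) \sum_(e | edge_of e K)
     edge_ip e (tr3 (out_normal K e) (tau K)) (mu e).

Definition S1_single tau : Prop :=
  forall (i : I) K K', K \in elts M -> K' \in elts M -> i \in K -> i \in K' ->
    map_mx (peval^~ (x_ i)) (tau K) = map_mx (peval^~ (x_ i)) (tau K').

Definition S2_single (l : nat) tau : Prop :=
  forall (e : edge) K K', K \in elts M -> K' \in elts M ->
    edge_of e K -> edge_of e K' ->
    forall q, deg1_le (l - 2) q ->
      edge_ip e (bilin (edge_normal e) (edge_normal e) (tau K)) q =
      edge_ip e (bilin (edge_normal e) (edge_normal e) (tau K')) q.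

Definition S3_single (l : nat) tau : Prop :=
  forall (e : edge) K K', K \in elts M -> K' \in elts M ->
    edge_of e K -> edge_of e K' ->
    forall q, deg1_le (l - 1) q ->
      edge_ip e (tr3 (edge_normal e) (tau K)) q =
      edge_ip e (tr3 (edge_normal e) (tau K')) q.

(* org K is the origin of the coordinates used on K. *)
Definition Sigmat_h (l k : nat) (org : elt -> R * R) tau : Prop :=
  [/\ forall K, K \in elts M -> Sigma_loc l k (org K) (tau K),
      S1_single tau & S2_single l tau].

Definition Sigma_h (l k : nat) (org : elt -> R * R) tau : Prop :=
  Sigmat_h l k org tau /\ S3_single l tau.

Definition Q_h (k : nat) v : Prop :=
  forall K, K \in elts M -> deg_le (k - 2) (v K).

Definition Lambda_h (l : nat) mu : Prop :=
  (forall e, is_iedge e -> deg1_le (l - 1) (mu e)) /\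
  (forall e, is_edge e -> ~~ is_iedge e -> mu e = 0).

Definition mixed_solution (l k : nat) (org : elt -> R * R)
    (Omega : set (R * R)) (f : R * R -> R) sig u : Prop :=
  [/\ Sigma_h l k org sig, Q_h k u,
      forall tau, Sigma_h l k org tau -> ip_tens sig tau + ip_divdiv tau u = 0 &
      forall v, Q_h k v -> ip_divdiv sig v = load Omega f v].

Definition hybrid_solution (l k : nat) (org : elt -> R * R)
    (Omega : set (R * R)) (f : R * R -> R) sig u lam : Prop :=
  [/\ Sigmat_h l k org sig, Q_h k u, Lambda_h l lam,
      forall tau, Sigmat_h l k org tau -> ip_tens sig tau + b_h tau u lam = 0 &
      forall v mu, Q_h k v -> Lambda_h l mu -> b_h sig v mu = load Omega f v].

End MeshDefs.

(* Main.v *)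
(* Testing the hybridized method with [v = 0] shows that the trace (S3) of
   [sigmat] does not jump, so that [sigmat] belongs to [Sigma_h]; for test tensors
   in [Sigma_h] the multiplier drops out, and [(sigmat, ut)] solves the mixed
   method.  The energy identity yields [sigmat = sigma], and it remains to see that
   a [v] in [Q_h] orthogonal to [divdiv Sigma_h] vanishes.

   This needs no Green formula.  Among the elements on which [v] is nonzero there is
   one, [K], with an edge [e] shared with no other such element.  Let [y] be the
   position relative to the vertex of [K] opposite to [e], and [A], [B] the
   barycentric coordinates of the ends of [e].  The traces of
   [q y y^T + sym curl (A B psi)] vanish on the two other edges; [q] can be chosen
   such that the [divdiv] of this tensor is [v], and [psi] such that it vanishes
   at the vertices.  A tensor of the same form on the other element containing [e],
   if any, has the same traces on [e].  Together they are an element of [Sigma_h],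
   and testing with it gives that the integral of [v ^ 2] over [K] is zero. *)

(* A tensor supported on a few triangles cannot have an arbitrary [divdiv]. To extend by zero inside
   [Sigma_h] it must vanish at the vertices and have zero traces on the outer edges. If all edges of
   the patch are treated so, Green's formula makes the moments of its [divdiv] against affine
   functions sum to zero over the patch. The element next to [K] must therefore compensate the
   affine moments of [v] on [K]. This is harmless exactly when [v] is zero on that element, which is
   why an edge shared with no other element of the support of [v] is sought.

   In the construction on the neighbour the three affine moments reappear as three scalar equations,
   solved by the three vertex values of an affine factor [q]. Such a [q] is admissible because
   [3 <= k]. The inequality [k - 1 <= l] bounds the degree of the source factor by [l - 1], so that
   both traces have the degrees that the bubble term on the neighbour can match. Equal traces are
   obtained as polynomials on the edge, which is stronger than equal moments. *)
From HB Require Import structures.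
Require Import Defs.
From mathcomp Require Import all_boot all_order all_algebra.
From mathcomp Require Import all_classical all_reals all_analysis.
From mathcomp Require Import ring lra.

Set Implicit Arguments.
Unset Strict Implicit.
Unset Printing Implicit Defensive.

Import Order.TTheory GRing.Theory Num.Theory.
Import numFieldNormedType.Exports.

Local Open Scope classical_set_scope.
Local Open Scope ring_scope.

Local Notation "c %:C" := (mpoly.mpolyC 2 c) (at level 2, format "c %:C").
Local Notation X_ := (fun i => mpoly.mpolyX _ (mpoly.mnm1 i)).
(* [rot] alone is the rotation of sequences. *)
Local Notation rot := Defs.rot.

(** * Polynomials in two variables *)

Section Polynomials.
Context {R : realType}.
Implicit Types (p q : poly2 R) (c x : R * R) (a : R).

Lemma sum_ord2 (V : nmodType) (F : 'I_2 -> V) : \sum_i F i = F ord0 + F ord_max.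
Proof. by rewrite big_ord_recr big_ord1 /=; congr (F _ + _); apply/val_inj. Qed.

Lemma ord2P (i : 'I_2) : i = ord0 \/ i = ord_max.
Proof. by case: i => [[|[|//]] ?]; [left|right]; apply/val_inj. Qed.

(** Polynomials are generated by constants and coordinates. The chain rule, measurability,
    continuity and boundedness below are proved through this principle. *)
Lemma poly2_ind (P : poly2 R -> Prop) :
  (forall a, P a%:C) -> (forall i, P (X_ i)) ->
  (forall p q, P p -> P q -> P (p + q)) -> (forall p q, P p -> P q -> P (p * q)) ->
  forall p, P p.
Proof.
move=> PC PX PD PM p; rewrite (mpoly.mpolyE p).
apply: (big_ind P) => [|//|m _]; first by rewrite -(mpoly.mpolyC0 2).
rewrite -mpoly.mul_mpolyC; apply: (PM) => //.
rewrite mpoly.mpolyXE_id; apply: (big_ind P) => [|u v|i _].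
- by rewrite -(mpoly.mpolyC1 2).
- exact: PM.
elim: (m i) => [|j IH]; first by rewrite expr0 -(mpoly.mpolyC1 2).
by rewrite exprS; apply: (PM).
Qed.

Lemma pdD i p q : pd i (p + q) = pd i p + pd i q.
Proof. exact: mpoly.mderivD. Qed.

Lemma pdN i p : pd i (- p) = - pd i p.
Proof. exact: mpoly.mderivN. Qed.

Lemma pdM i p q : pd i (p * q) = pd i p * q + p * pd i q.
Proof. exact: mpoly.mderivM. Qed.

Lemma pdC i (a : R) : pd i a%:C = 0.
Proof. exact: mpoly.mderivC. Qed.

Lemma pdX i j : pd i (X_ j) = (i == j)%:R :> poly2 R.
Proof.
apply/mpoly.mpolyP => m; rewrite mpoly.mcoeff_deriv mpoly.mcoeffX.
rewrite -mpoly.mpolyC_nat mpoly.mcoeffC; case: (eqVneq i j) => [<-|ij].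
  rewrite mul1r [mpoly.mnm_add m _]mpoly.addmC -[X in X == _]mpoly.addm0.
  rewrite (inj_eq (@mpoly.addmI _ _)) eq_sym.
  by case: eqP => [->|_]; rewrite ?mul0rn // mpoly.mnm0E.
rewrite mul0r; case: eqP => [/(congr1 (fun m : mpoly.multinom 2 => m i))|].
  by rewrite mpoly.mnmDE !mpoly.mnm1E eqxx [j == i]eq_sym (negbTE ij) addn1.
by rewrite mul0rn.
Qed.

Lemma pd0 i : pd i (0 : poly2 R) = 0.
Proof. exact: mpoly.mderiv0. Qed.

Lemma pd1 i : pd i (1 : poly2 R) = 0.
Proof. by rewrite -(mpoly.mpolyC1 2) pdC. Qed.

Lemma pd_comm i j p : pd i (pd j p) = pd j (pd i p).
Proof. exact: mpoly.mderiv_comm. Qed.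

Lemma pd_swap p : pd ord0 (pd ord_max p) = pd ord_max (pd ord0 p).
Proof. exact: pd_comm. Qed.

Lemma msize_leP n p :
  reflect (forall m, (n <= mpoly.mdeg m)%N -> mpoly.mcoeff m p = 0) (mpoly.msize p <= n)%N.
Proof.
apply: (iffP idP) => [pn m nm|H].
  apply/eqP; rewrite mpoly.mcoeff_eq0; apply: mpoly.msize_mdeg_ge.
  exact: leq_trans nm.
rewrite mpoly.msizeE; apply/bigmax_leqP_seq => m mp _.
rewrite ltnNge; apply/negP => /H /eqP.
by rewrite mpoly.mcoeff_eq0 mp.
Qed.

Lemma msizeD n p q :
  (mpoly.msize p <= n)%N -> (mpoly.msize q <= n)%N -> (mpoly.msize (p + q) <= n)%N.
Proof.
move=> pn qn; apply: leq_trans (mpoly.msizeD_le _ _) _.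
by rewrite geq_max pn.
Qed.

Lemma msize_pd i n p : (mpoly.msize p <= n.+1)%N -> (mpoly.msize (pd i p) <= n)%N.
Proof.
move=> /msize_leP H; apply/msize_leP => m nm.
by rewrite mpoly.mcoeff_deriv H ?mul0rn // mpoly.mdegD mpoly.mdeg1 addn1.
Qed.

Lemma deg_leD n p q : deg_le n p -> deg_le n q -> deg_le n (p + q).
Proof. exact: msizeD. Qed.

Lemma deg_leN n p : deg_le n p -> deg_le n (- p).
Proof. by rewrite /deg_le mpoly.msizeN. Qed.

Lemma deg_leB n p q : deg_le n p -> deg_le n q -> deg_le n (p - q).
Proof. by move=> pn /deg_leN; apply: deg_leD. Qed.

Lemma deg_le_trans n m p : (n <= m)%N -> deg_le n p -> deg_le m p.
Proof. by move=> nm; rewrite /deg_le => /leq_trans; apply; rewrite ltnS. Qed.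

Lemma deg_leM n m p q : deg_le n p -> deg_le m q -> deg_le (n + m) (p * q).
Proof.
rewrite /deg_le => pn qm.
have [->|p0] := eqVneq p 0; first by rewrite mul0r mpoly.mmeasure0.
have [->|q0] := eqVneq q 0; first by rewrite mulr0 mpoly.mmeasure0.
rewrite mpoly.msizeM // -subn1 leq_subLR.
by apply: leq_trans (leq_add pn qm) _; rewrite add1n addSn addnS.
Qed.

Lemma deg_leC n (a : R) : deg_le n a%:C.
Proof. by rewrite /deg_le mpoly.msizeC; case: eqP. Qed.

Lemma deg_le0 n : deg_le n (0 : poly2 R).
Proof. by rewrite /deg_le mpoly.mmeasure0. Qed.

Lemma deg_leX i : deg_le 1 (X_ i : poly2 R).
Proof. by rewrite /deg_le mpoly.msizeX mpoly.mdeg1. Qed.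

Lemma deg_le_pd i n p : deg_le n.+1 p -> deg_le n (pd i p).
Proof. exact: msize_pd. Qed.

Lemma deg_leZ n (a : R) p : deg_le n p -> deg_le n (a *: p).
Proof. by move=> pn; rewrite -mpoly.mul_mpolyC -[n]add0n; apply: deg_leM => //; apply: deg_leC. Qed.

Lemma coordE c i : coordv c i 0 = X_ i - (vec c i 0)%:C.
Proof. by rewrite mxE. Qed.

Lemma deg_le_coord c i : deg_le 1 (coordv c i 0).
Proof. by rewrite coordE; apply: deg_leB; [apply: deg_leX|apply: deg_leC]. Qed.

Lemma pd_coord c i j : pd i (coordv c j 0) = (i == j)%:R.
Proof. by rewrite coordE pdD pdN pdC subr0 pdX. Qed.

(** The radial derivative about [c]. On polynomials homogeneous in the coordinates centred at [c] it
    multiplies by the degree, so adding a positive constant makes it bijective on each P_n. *)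
Definition euler c p : poly2 R := \sum_i coordv c i 0 * pd i p.

Lemma eulerE c p :
  euler c p = coordv c ord0 0 * pd ord0 p + coordv c ord_max 0 * pd ord_max p.
Proof. by rewrite /euler sum_ord2. Qed.

Lemma deg_le_euler c n p : deg_le n p -> deg_le n (euler c p).
Proof.
case: n => [p0|n pn]; rewrite eulerE.
  have H i : pd i p = 0.
    apply/eqP; rewrite -mpoly.msize_poly_eq0 -leqn0; exact: msize_pd.
  by rewrite !H !mulr0 addr0; apply: deg_le0.
by apply: deg_leD; rewrite -[n.+1]add1n; apply: deg_leM (deg_le_coord _ _) _; apply: deg_le_pd.
Qed.

Lemma pd_euler c i p : pd i (euler c p) = euler c (pd i p) + pd i p.
Proof.
rewrite !eulerE pdD !pdM !pd_coord.
by case: (ord2P i) => -> /=; rewrite ?pd_swap; ring.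
Qed.

Lemma eulerD c p q : euler c (p + q) = euler c p + euler c q.
Proof. by rewrite !eulerE !pdD; ring. Qed.

Lemma eulerZ c (a : R) p : euler c (a%:C * p) = a%:C * euler c p.
Proof. by rewrite !eulerE !pdM !pdC; ring. Qed.

(** By [pd_euler], each partial derivative of [p] satisfies the same equation with [s.+1], and has
    lower degree. Once these vanish, the equation reads s p = 0. *)
Lemma euler_inj c s p : (0 < s)%N -> euler c p + s%:R%:C * p = 0 -> p = 0.
Proof.
move: {2}(mpoly.msize p) (leqnn (mpoly.msize p)) => n.
elim: n s p => [|n IH] s p pn s0 H.
  by apply/eqP; rewrite -mpoly.msize_poly_eq0 -leqn0.
have pd_eq0 i : pd i p = 0.
  apply: (IH s.+1) => //; first exact: msize_pd.
  move/(congr1 (pd i)): H; rewrite pd0 pdD pd_euler pdM pdC => H.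
  by rewrite -[RHS]H -natr1 rmorphD rmorph1; ring.
move: H; rewrite eulerE !pd_eq0 !mulr0 !add0r => /eqP.
by rewrite mulf_eq0 mpoly.mpolyC_eq0 pnatr_eq0 eqn0Ngt s0 => /eqP.
Qed.

Lemma X_pd_monomial i (m : mpoly.multinom 2) :
  X_ i * pd i (mpoly.mpolyX R m) = (m i)%:R%:C * mpoly.mpolyX R m.
Proof.
rewrite /pd mpoly.mderivX -mpoly.mul_mpolyC mulrCA.
case: (posnP (m i)) => [->|mi]; first by rewrite rmorph0 !mul0r.
rewrite -mpoly.mpolyXD mpoly.addmC mpoly.submK //.
by rewrite mpoly.lep1mP -lt0n.
Qed.

(** For the centre 0, divide each coefficient of total degree d by d + s. Moving the centre to [c]
    leaves an error of lower degree, removed by induction. *)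
Lemma euler_surj c s n p : (0 < s)%N -> deg_le n p ->
  exists2 q, deg_le n q & euler c q + s%:R%:C * q = p.
Proof.
(* The bound is shifted by one so that the induction starts at the zero polynomial. *)
move=> s0; rewrite /deg_le; move: n.+1 => {}n.
elim: n p => [|n IH] p pn.
  exists 0; first by rewrite mpoly.mmeasure0.
  apply/esym/eqP; rewrite eulerE !pd0 !mulr0 !addr0.
  by rewrite -mpoly.msize_poly_eq0 -leqn0.
pose f m : R := mpoly.mcoeff m p / (mpoly.mdeg m + s)%:R.
pose q := \sum_(m <- mpoly.msupp p) (f m)%:C * mpoly.mpolyX R m.
have qn : (mpoly.msize q <= n.+1)%N.
  rewrite /q big_seq; apply: (big_ind (fun q => deg_le n q)) => [||m mp].
  - exact: deg_le0.
  - exact: deg_leD.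
  - rewrite mpoly.mul_mpolyC; apply: deg_leZ; rewrite /deg_le mpoly.msizeX.
    exact: leq_trans (mpoly.msize_mdeg_lt mp) pn.
have Eq : \sum_i X_ i * pd i q + s%:R%:C * q = p.
  rewrite [RHS](mpoly.mpolyE p) /q [X in _ + X]mulr_sumr.
  under eq_bigr => i _.
    rewrite (_ : pd i _ = \sum_(m <- mpoly.msupp p) (f m)%:C * pd i (mpoly.mpolyX R m)).
      rewrite mulr_sumr; over.
    elim/big_rec2 : _ => [|m u v _ <-]; first exact: pd0.
    by rewrite pdD pdM pdC mul0r add0r.
  rewrite exchange_big -big_split /=; apply: eq_bigr => m _.
  under eq_bigr do rewrite mulrCA X_pd_monomial mulrA.
  rewrite -mulr_suml mulrA -mulrDl -mpoly.mul_mpolyC; congr (_ * _).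
  under eq_bigr do rewrite -rmorphM.
  rewrite -rmorph_sum -rmorphM -rmorphD /= -mulr_sumr; congr (_ %:C).
  rewrite -natr_sum [(\sum_i m i)%N](_ : _ = mpoly.mdeg m); last first.
    by rewrite mpoly.mdegE.
  rewrite [s%:R * _]mulrC -mulrDr -natrD /f divfK //.
  by rewrite pnatr_eq0 addn_eq0 [s == 0%N]eqn0Ngt s0 andbF.
have [|q' q'n Eq'] := IH (\sum_i (vec c i 0)%:C * pd i q).
  apply: (big_ind (fun q : poly2 R => (mpoly.msize q <= n)%N)) => [||i _].
  - by rewrite mpoly.mmeasure0.
  - by move=> u v; apply: msizeD.
  - rewrite mpoly.mul_mpolyC; apply: leq_trans (mpoly.msizeZ_le _ _) _; exact: msize_pd.
exists (q + q'); first by apply: msizeD => //; apply: leq_trans q'n _.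
apply: etrans Eq; rewrite eulerD mulrDr addrACA Eq' eulerE !sum_ord2 !coordE; ring.
Qed.

Lemma pevalD p q x : peval (p + q) x = peval p x + peval q x.
Proof. exact: mpoly.mevalD. Qed.
Lemma pevalN p x : peval (- p) x = - peval p x.
Proof. exact: mpoly.mevalN. Qed.
Lemma pevalM p q x : peval (p * q) x = peval p x * peval q x.
Proof. exact: mpoly.mevalM. Qed.
Lemma pevalC a x : peval a%:C x = a.
Proof. exact: mpoly.mevalC. Qed.
Lemma pevalX i x : peval (X_ i) x = vec x i 0.
Proof. exact: mpoly.mevalXU. Qed.
Lemma peval0 x : peval (0 : poly2 R) x = 0.
Proof. exact: mpoly.meval0. Qed.
Lemma peval1 x : peval (1 : poly2 R) x = 1.
Proof. exact: mpoly.meval1. Qed.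

(** The pullback to the segment from [y] to [z]. As a substitution it is a ring morphism into
    univariate polynomials, so traces can be factored, differentiated and measured by degree. *)
Definition restr (y z : R * R) p : {poly R} :=
  mpoly.mmap (@polyC R) (fun i => (vec y i 0)%:P + (vec z i 0 - vec y i 0)%:P * 'X) p.

Lemma restrE y z p s : (restr y z p).[s] = peval p (seg y z s).
Proof.
rewrite /restr /peval /mpoly.meval /mpoly.mmap horner_sum; apply: eq_bigr => m _.
rewrite hornerM hornerC /=; congr (_ * _); rewrite /mpoly.mmap1 horner_prod.
apply: eq_bigr => i _; rewrite horner_exp; congr (_ ^+ _).
rewrite hornerD hornerM !hornerC hornerX !mxE /seg.
by case: ifP => _ /=; ring.
Qed.

HB.instance Definition _ y z := GRing.RMorphism.copy (restr y z)
  (mpoly.mmap (@polyC R) (fun i => (vec y i 0)%:P + (vec z i 0 - vec y i 0)%:P * 'X)).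

Lemma restrC y z (u : R) : restr y z u%:C = u%:P.
Proof. exact: mpoly.mmapC. Qed.

Lemma restrX y z i : restr y z (X_ i) = (vec y i 0)%:P + (vec z i 0 - vec y i 0)%:P * 'X.
Proof. by rewrite /restr mpoly.mmapX mpoly.mmap1U. Qed.

Lemma dirdE u p : dird u p = (u ord0 0)%:C * pd ord0 p + (u ord_max 0)%:C * pd ord_max p.
Proof. by rewrite /dird sum_ord2 !mpoly.mul_mpolyC. Qed.

Lemma dirdD u p q : dird u (p + q) = dird u p + dird u q.
Proof. by rewrite !dirdE !pdD; ring. Qed.
Lemma dirdM u p q : dird u (p * q) = dird u p * q + p * dird u q.
Proof. by rewrite !dirdE !pdM; ring. Qed.
Lemma dirdC u a : dird u a%:C = 0.
Proof. by rewrite !dirdE !pdC; ring. Qed.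

Lemma deriv_restr y z p : (restr y z p)^`() = restr y z (dird (vec z - vec y) p).
Proof.
elim/poly2_ind: p => [u|i|p q Hp Hq|p q Hp Hq].
- by rewrite dirdC rmorph0 restrC derivC.
- rewrite restrX derivD derivM !derivC derivX dirdE !pdX.
  case: (ord2P i) => -> /=; rewrite ?mulr1 ?mulr0 ?addr0 ?add0r restrC !mxE /=; ring.
- by rewrite dirdD !rmorphD /= derivD Hp Hq.
- by rewrite dirdM rmorphD !rmorphM /= derivM Hp Hq.
Qed.

Lemma size_restr y z p n : deg_le n p -> (size (restr y z p) <= n.+1)%N.
Proof.
move=> pn; rewrite /restr /mpoly.mmap big_seq; apply: (big_ind (fun q : {poly R} => (size q <= n.+1)%N)).
- by rewrite size_poly0.
- by move=> u v un vn; apply: leq_trans (size_polyD _ _) _; rewrite geq_max un.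
move=> m mp.
have dm : (mpoly.mdeg m <= n)%N by rewrite -ltnS; apply: leq_trans (mpoly.msize_mdeg_lt mp) pn.
rewrite mul_polyC; apply: leq_trans (size_scale_leq _ _) _.
apply: leq_trans (_ : (mpoly.mdeg m).+1 <= _)%N; last by [].
rewrite /mpoly.mmap1 mpoly.mdegE.
have lin i k : (size (((vec y i 0)%:P + (vec z i 0 - vec y i 0)%:P * 'X) ^+ k)%R <= k.+1)%N.
  apply: leq_trans (size_poly_exp_leq _ _) _; rewrite ltnS.
  have : (size ((vec y i 0)%:P + (vec z i 0 - vec y i 0)%:P * 'X)%R <= 2)%N.
    by rewrite addrC size_MXaddC; case: ifP => // _; rewrite ltnS size_polyC_leq1.
  by case: (size _) => [|[|[|]]] //= _; rewrite ?mul0n ?mul1n.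
rewrite sum_ord2 big_ord_recl big_ord1 /=.
apply: leq_trans (size_polyMleq _ _) _.
rewrite (_ : lift ord0 ord0 = ord_max); last by apply/val_inj.
have := leq_add (lin ord0 (m ord0)) (lin ord_max (m ord_max)).
rewrite addSn addnS; case: addn => //.
Qed.

End Polynomials.

(** * Decomposition of polynomial tensors *)

Section Decomposition.
Context {R : realType}.
Implicit Types (p q : poly2 R) (c : R * R) (tau : 'M[poly2 R]_2) (phi : 'cV[poly2 R]_2).

Lemma mx2P (T : Type) (A B : 'M[T]_2) :
  A ord0 ord0 = B ord0 ord0 -> A ord0 ord_max = B ord0 ord_max ->
  A ord_max ord0 = B ord_max ord0 -> A ord_max ord_max = B ord_max ord_max -> A = B.
Proof.
by move=> *; apply/matrixP => i j; case: (ord2P i) => ->; case: (ord2P j) => ->.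
Qed.

(** To [ring] the constant polynomial 1/2 is an atom. This relation supplies its value where the
    factor of [sym] has to cancel. *)
Lemma halfK : 1 - (2^-1%:C + 2^-1%:C) = 0 :> poly2 R.
Proof. by rewrite -rmorphD -mulr2n -[_ *+ 2]mulr_natr mulVf ?pnatr_eq0 // rmorph1 subrr. Qed.

Lemma half2 p : 2^-1%:C * (p + p) = p.
Proof. by apply/eqP; rewrite eq_sym -subr_eq0 -[X in _ == X](mul0r p) -halfK; apply/eqP; ring. Qed.

Lemma symcurl00 phi : sym (curlv phi) ord0 ord0 = pd ord_max (phi ord0 0).
Proof. by rewrite !mxE /= -mpoly.mul_mpolyC half2. Qed.

Lemma symcurl11 phi : sym (curlv phi) ord_max ord_max = - pd ord0 (phi ord_max 0).
Proof. by rewrite !mxE /= -mpoly.mul_mpolyC half2. Qed.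

Lemma symcurl01 phi : sym (curlv phi) ord0 ord_max =
  2^-1%:C * (pd ord_max (phi ord_max 0) - pd ord0 (phi ord0 0)).
Proof. by rewrite !mxE /= -mpoly.mul_mpolyC addrC. Qed.

Lemma symcurl10 phi : sym (curlv phi) ord_max ord0 =
  2^-1%:C * (pd ord_max (phi ord_max 0) - pd ord0 (phi ord0 0)).
Proof. by rewrite !mxE /= -mpoly.mul_mpolyC. Qed.

Lemma scale_yyE c q i j :
  (q *: (coordv c *m (coordv c)^T)) i j = q * (coordv c i 0 * coordv c j 0).
Proof. by rewrite mxE mxE big_ord1 [_^T _ _]mxE. Qed.

Lemma divdivE tau : divdiv tau =
  pd ord0 (pd ord0 (tau ord0 ord0) + pd ord_max (tau ord0 ord_max)) +
  pd ord_max (pd ord0 (tau ord_max ord0) + pd ord_max (tau ord_max ord_max)).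
Proof. by rewrite /divdiv /divv sum_ord2 !mxE !sum_ord2. Qed.

Lemma divdivD tau1 tau2 : divdiv (tau1 + tau2) = divdiv tau1 + divdiv tau2.
Proof. by rewrite !divdivE !mxE !pdD; ring. Qed.

Lemma divdivN tau : divdiv (- tau) = - divdiv tau.
Proof. by rewrite !divdivE !mxE !(pdD, pdN); ring. Qed.

Lemma divdiv_symcurl phi : divdiv (sym (curlv phi)) = 0.
Proof.
rewrite divdivE symcurl00 symcurl01 symcurl10 symcurl11.
rewrite !(pdD, pdN, pdM, pdC, pd_swap).
rewrite -[RHS](mul0r (pd ord_max (pd ord0 (pd ord0 (phi ord0 0))) -
  pd ord_max (pd ord_max (pd ord0 (phi ord_max 0))))) -[X in _ = X * _]halfK; ring.
Qed.

Lemma divdiv_yy c q :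
  divdiv (q *: (coordv c *m (coordv c)^T)) =
  euler c (euler c q + 2%:R%:C * q) + 3%:R%:C * (euler c q + 2%:R%:C * q).
Proof.
rewrite divdivE !scale_yyE !eulerE !(pdD, pdM, pdC, pd_coord, pd1, pd0, pd_swap) /=.
by rewrite !rmorph_nat; ring.
Qed.

(** With E the Euler operator about [c], the left side is (E + 3)(E + 2) q, and each factor maps P_n
    onto itself. *)
Lemma divdiv_yy_surj c n p : deg_le n p ->
  exists2 q, deg_le n q & divdiv (q *: (coordv c *m (coordv c)^T)) = p.
Proof.
move=> /(euler_surj c (isT : (0 < 3)%N))[u un <-].
have [q qn <-] := euler_surj c (isT : (0 < 2)%N) un.
by exists q => //; rewrite divdiv_yy.
Qed.

(** The Poincare lemma with the radial homotopy. Writing w = (E + 1) v means that v is the integral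
    of w(c + s y) over s in [0, 1]. Then (E + 2) div v = div w = 0, so v is divergence-free as well,
    and y_2 v_1 - y_1 v_2 is a potential of w. *)
Lemma curl_potential c n (w0 w1 : poly2 R) : deg_le n w0 -> deg_le n w1 ->
  pd ord0 w0 + pd ord_max w1 = 0 ->
  exists p, [/\ deg_le n.+1 p, pd ord_max p = w0 & - pd ord0 p = w1].
Proof.
move=> /(euler_surj c (isT : (0 < 1)%N))[v0 n0 E0].
move=> /(euler_surj c (isT : (0 < 1)%N))[v1 n1 E1].
rewrite -E0 -E1 rmorph1 !mul1r !pdD !pd_euler => H.
have dv : pd ord0 v0 + pd ord_max v1 = 0.
  apply: (@euler_inj _ c 2) => //; rewrite -[RHS]H eulerD rmorph_nat; ring.
have dv0 : pd ord0 v0 = - pd ord_max v1 by apply/eqP; rewrite -addr_eq0 dv.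
exists (coordv c ord_max 0 * v0 - coordv c ord0 0 * v1); split.
- by rewrite -add1n; apply: deg_leB; apply: deg_leM (deg_le_coord _ _) _.
- by rewrite pdD pdN !pdM !pd_coord eulerE dv0 /=; ring.
- by rewrite pdD pdN !pdM !pd_coord eulerE dv0 /=; ring.
Qed.

(** Subtract the q y y^T with the same [divdiv]. The divergence of the remainder is itself
    divergence-free, hence the curl of some p. Adding to the remainder the skew matrix with entries
    -p and p makes both rows divergence-free, hence curls, and [sym] removes that skew matrix
    again. *)
Lemma symcurl_decomp c m tau :
  (forall i j, deg_le m.+2 (tau i j)) -> tau ord0 ord_max = tau ord_max ord0 ->
  exists (phi : 'cV[poly2 R]_2) (q : poly2 R),
    [/\ forall i, deg_le m.+3 (phi i 0), deg_le m q &
        tau = sym (curlv phi) + q *: (coordv c *m (coordv c)^T)].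
Proof.
move=> taum taus.
have ddm : deg_le m (divdiv tau).
  by rewrite divdivE; do ![apply: deg_leD | apply: deg_le_pd | apply: taum].
have [q qm Eq] := divdiv_yy_surj c ddm.
set yy := coordv c *m _ in Eq; pose t := tau - q *: yy.
have tE i j : t i j = tau i j - q * (coordv c i 0 * coordv c j 0).
  by rewrite mxE [X in _ + X]mxE scale_yyE.
have tm i j : deg_le m.+2 (t i j).
  rewrite tE; apply: deg_leB => //.
  rewrite -addn2; apply: deg_leM => //.
  by rewrite -[2%N]/(1 + 1)%N; apply: deg_leM; apply: deg_le_coord.
have t0 : divdiv t = 0 by rewrite divdivD divdivN Eq subrr.
have ts : t ord0 ord_max = t ord_max ord0.
  by rewrite !tE taus; ring.
move: t0; rewrite divdivE => t0.
have [||p [pm p0 p1]] := curl_potential c (n := m.+1) _ _ t0.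
- by do ![apply: deg_leD | apply: deg_le_pd | apply: tm].
- by do ![apply: deg_leD | apply: deg_le_pd | apply: tm].
have [|||f0 [f0m f00 f01]] := curl_potential c (n := m.+2)
    (w0 := t ord0 ord0) (w1 := t ord0 ord_max - p).
- exact: tm.
- exact: deg_leB.
- by rewrite pdD pdN p0; ring.
have [|||f1 [f1m f10 f11]] := curl_potential c (n := m.+2)
    (w0 := t ord_max ord0 + p) (w1 := t ord_max ord_max).
- exact: deg_leD.
- exact: tm.
- by rewrite pdD -(opprK (pd ord0 p)) p1; ring.
exists (\col_i if i == ord0 then f0 else f1), q; split => // [i|].
  by rewrite mxE; case: ifP.
rewrite -[tau](subrK (q *: yy)) -/t; congr (_ + _).
have phiE i : (\col_i if i == ord0 then f0 else f1) i 0 = if i == ord0 then f0 else f1.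
  by rewrite mxE.
apply: mx2P; rewrite ?symcurl00 ?symcurl01 ?symcurl10 ?symcurl11 !phiE /=.
- by rewrite f00.
- by rewrite f01 f10 -ts -[LHS]half2; congr (_ * _); ring.
- by rewrite f01 f10 -ts -[LHS]half2; congr (_ * _); ring.
- by rewrite f11.
Qed.

End Decomposition.

(** * Traces and tensors on one element *)

Section EdgeData.
Context {R : realType}.
Implicit Types (q : poly2 R) (c : R * R) (tau : 'M[poly2 R]_2) (phi : 'cV[poly2 R]_2).
Implicit Types (n u v : 'cV[R]_2).

Definition dotp u phi : poly2 R := (u ord0 0)%:C * phi ord0 0 + (u ord_max 0)%:C * phi ord_max 0.

Lemma rot0 n : rot n ord0 0 = - n ord_max 0. Proof. by rewrite mxE. Qed.
Lemma rot1 n : rot n ord_max 0 = n ord0 0. Proof. by rewrite mxE. Qed.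

Lemma bilinE u v tau : bilin u v tau =
  (u ord0 0)%:C * (v ord0 0)%:C * tau ord0 ord0 +
  (u ord0 0)%:C * (v ord_max 0)%:C * tau ord0 ord_max +
  (u ord_max 0)%:C * (v ord0 0)%:C * tau ord_max ord0 +
  (u ord_max 0)%:C * (v ord_max 0)%:C * tau ord_max ord_max.
Proof.
rewrite /bilin mxE sum_ord2 !mxE !sum_ord2 !mxE /=; ring.
Qed.

Lemma tr3E n tau : tr3 n tau = dird (rot n) (bilin (rot n) n tau) +
  ((n ord0 0)%:C * (pd ord0 (tau ord0 ord0) + pd ord_max (tau ord0 ord_max)) +
   (n ord_max 0)%:C * (pd ord0 (tau ord_max ord0) + pd ord_max (tau ord_max ord_max))).
Proof. by rewrite /tr3 mxE sum_ord2 !mxE !sum_ord2. Qed.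

Lemma bilinD u v tau1 tau2 : bilin u v (tau1 + tau2) = bilin u v tau1 + bilin u v tau2.
Proof. by rewrite !bilinE !mxE; ring. Qed.

Local Opaque pd dird bilin.

Lemma tr3D n tau1 tau2 : tr3 n (tau1 + tau2) = tr3 n tau1 + tr3 n tau2.
Proof.
rewrite !tr3E bilinD dirdD !mxE !pdD.
move: (dird _ _) (dird _ _) (pd _ _) (pd _ _) (pd _ _) (pd _ _) (pd _ _) (pd _ _) (pd _ _) (pd _ _).
move: (_%:C) (_%:C) => *.
ring.
Qed.

Lemma tr3N n tau : tr3 (- n) tau = - tr3 n tau.
Proof.
rewrite !tr3E !dirdE !rot0 !rot1 !bilinE !rot0 !rot1.
have E i : (- n) i 0 = - n i 0 by rewrite mxE.
by rewrite !E !(pdD, pdM, pdC); ring.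
Qed.

(* Eliminating this derivative keeps the factor 1/2 of [sym] out of the trace
   identities. *)
Lemma symcurl_trace phi : pd ord_max (phi ord_max 0) =
  sym (curlv phi) ord0 ord_max + sym (curlv phi) ord0 ord_max + pd ord0 (phi ord0 0).
Proof.
rewrite symcurl01 -mulrDr half2; ring.
Qed.

Lemma symcurl_sym phi : sym (curlv phi) ord_max ord0 = sym (curlv phi) ord0 ord_max.
Proof. by rewrite symcurl01 symcurl10. Qed.

(** Here and in [tr3_symcurl] the traces are tangential derivatives only, so on an edge they depend
    on nothing but the values of [phi] on that edge. *)
Lemma bilin_symcurl n phi : bilin n n (sym (curlv phi)) = dird (rot n) (dotp n phi).
Proof.
rewrite bilinE symcurl_sym symcurl00 symcurl11 dirdE rot0 rot1 /dotp !(pdD, pdM, pdC).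
by rewrite symcurl_trace; ring.
Qed.

Lemma tr3_symcurl n phi : n ord0 0 ^+ 2 + n ord_max 0 ^+ 2 = 1 ->
  tr3 n (sym (curlv phi)) = dird (rot n) (dird (rot n) (dotp (rot n) phi)).
Proof.
move=> n1.
(* The divergence term is linear in n and all others are cubic. The factor |n|^2 = 1 makes the
   identity homogeneous, so that [ring] can close it. *)
have key (w : poly2 R) : ((n ord0 0)%:C ^+ 2 + (n ord_max 0)%:C ^+ 2) * w = w.
  by rewrite -!rmorphXn -rmorphD n1 rmorph1 mul1r.
rewrite tr3E -[X in _ + X]key bilinE !rot0 !rot1 /= !dirdE !rot0 !rot1 /dotp !rot0 !rot1.
rewrite symcurl_sym symcurl00 symcurl11 !(pdD, pdM, pdC, pdN) -!pd_swap symcurl_trace.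
by rewrite !pdD -!pd_swap; ring.
Qed.

Lemma bilin_yy c u v q : bilin u v (q *: (coordv c *m (coordv c)^T)) =
  q * (dotp u (coordv c) * dotp v (coordv c)).
Proof. by rewrite bilinE !scale_yyE /dotp; ring. Qed.

(** The point is the factor n.y: it is constant on each line with normal n, and zero on the one
    through [c]. *)
Lemma tr3_yy c n q : tr3 n (q *: (coordv c *m (coordv c)^T)) =
  dotp n (coordv c) *
    (dird (rot n) (q * dotp (rot n) (coordv c)) + euler c q + 3%:R%:C * q).
Proof.
rewrite tr3E bilin_yy !dirdE !rot0 !rot1 /dotp !rot0 !rot1 !scale_yyE eulerE rmorph_nat.
by rewrite !(pdD, pdM, pdC, pd_coord, pdN) /=; ring.
Qed.

End EdgeData.

(** * Barycentric coordinates and the tensor attached to one edge of a triangle *)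

Section Element.
Context {R : realType}.
Implicit Types (q : poly2 R) (c p a b x : R * R) (tau : 'M[poly2 R]_2) (phi psi : 'cV[poly2 R]_2).
Implicit Types (n u v : 'cV[R]_2).

(** Twice the signed area of the triangle with vertices [p], [a], [b] in this order. *)
Definition area p b a : R := (a.1 - p.1) * (b.2 - p.2) - (a.2 - p.2) * (b.1 - p.1).

(** The barycentric coordinate of the last argument: zero on the line through [p] and [b], and 1 at
    [a] if the triangle is nondegenerate. It is locked so that [ring] sees an atom. *)
Definition bary p b a : poly2 R :=
  locked ((area p b a)^-1%:C *
    ((b.2 - p.2)%:C * coordv p ord0 0 - (b.1 - p.1)%:C * coordv p ord_max 0)).

Lemma areaC p a b : area p a b = - area p b a.
Proof. by rewrite /area; ring. Qed.

Lemma vec0 x : vec x ord0 0 = x.1. Proof. by rewrite mxE. Qed.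
Lemma vec1 x : vec x ord_max 0 = x.2. Proof. by rewrite mxE. Qed.

Lemma peval_coord p x i : peval (coordv p i 0) x = vec x i 0 - vec p i 0.
Proof. by rewrite coordE pevalD pevalN pevalX pevalC. Qed.

Lemma peval_bary p b a x : peval (bary p b a) x = area p b x / area p b a.
Proof.
rewrite /bary -lock !(pevalM, pevalD, pevalN, pevalC) !peval_coord !vec0 !vec1 /area; ring.
Qed.

Lemma pd_bary0 p b a : pd ord0 (bary p b a) = ((b.2 - p.2) / area p b a)%:C.
Proof.
rewrite /bary -lock !(pdM, pdD, pdN, pdC) !pd_coord /= !rmorphM /=; ring.
Qed.

Lemma pd_bary1 p b a : pd ord_max (bary p b a) = (- (b.1 - p.1) / area p b a)%:C.
Proof.
rewrite /bary -lock !(pdM, pdD, pdN, pdC) !pd_coord /= !rmorphM /=; ring.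
Qed.

Lemma deg_le_bary p b a : deg_le 1 (bary p b a).
Proof.
rewrite /bary -lock -[1%N]/(0 + 1)%N; apply: deg_leM (deg_leC _ _) _.
by apply: deg_leB; rewrite -[1%N]/(0 + 1)%N; apply: deg_leM (deg_leC _ _) _; apply: deg_le_coord.
Qed.

Lemma coord_bary p a b i : area p b a != 0 ->
  coordv p i 0 = (vec a i 0 - vec p i 0)%:C * bary p b a + (vec b i 0 - vec p i 0)%:C * bary p a b.
Proof.
move=> D0; have D1 : (area p b a)^-1%:C * (area p b a)%:C = 1 :> poly2 R.
  by rewrite -rmorphM mulVf // rmorph1.
rewrite -[LHS]mul1r -D1 /bary -!lock [area p a b]areaC invrN rmorphN /=.
move: D1; set h := (area p b a)^-1 => _.
by rewrite /area; case: (ord2P i) => ->; rewrite ?vec0 ?vec1; ring.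
Qed.

Lemma dotp_bary p a b n : area p b a != 0 ->
  dotp n (coordv p) =
  (dotv n (vec a - vec p))%:C * bary p b a + (dotv n (vec b - vec p))%:C * bary p a b.
Proof.
move=> D0; rewrite /dotp !(coord_bary _ D0) /dotv !sum_ord2 !mxE /=; ring.
Qed.

Definition elt_curl p a b psi : 'cV[poly2 R]_2 :=
  \col_i (bary p b a * bary p a b * psi i 0).

Definition elt_tens p a b q psi : 'M[poly2 R]_2 :=
  sym (curlv (elt_curl p a b psi)) + q *: (coordv p *m (coordv p)^T).

Lemma elt_curlE p a b psi i :
  elt_curl p a b psi i 0 = bary p b a * bary p a b * psi i 0.
Proof. by rewrite mxE. Qed.

Lemma elt_tensC p a b q psi : elt_tens p a b q psi = elt_tens p b a q psi.
Proof.
suff E : elt_curl p a b psi = elt_curl p b a psi by rewrite /elt_tens E.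
by apply/colP => i; rewrite !elt_curlE [bary p b a * _]mulrC.
Qed.

Lemma dotp_elt_curl p a b u psi :
  dotp u (elt_curl p a b psi) = bary p b a * bary p a b * dotp u psi.
Proof. by rewrite /dotp !elt_curlE; ring. Qed.

Lemma dird_bary_edge p a b n : dotv n (vec a - vec p) = 0 ->
  dird (rot n) (bary p a b) = 0.
Proof.
rewrite /dotv sum_ord2 !mxE /= => n0.
rewrite dirdE rot0 rot1 pd_bary0 pd_bary1 -!rmorphM -rmorphD /=.
rewrite [X in X%:C](_ : _ = - (n ord0 0 * (a.1 - p.1) + n ord_max 0 * (a.2 - p.2)) / area p a b); last by ring.
by rewrite n0 oppr0 mul0r rmorph0.
Qed.

(** On the line through [p] and [a], n.y is a multiple of B = [bary p a b], and B has zero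
    derivative along the line. So every term of both traces keeps a factor B, which vanishes
    there. *)
Lemma elt_tens_edge p a b q psi n x : area p b a != 0 ->
  dotv n (vec a - vec p) = 0 -> n ord0 0 ^+ 2 + n ord_max 0 ^+ 2 = 1 ->
  area p a x = 0 ->
  peval (bilin n n (elt_tens p a b q psi)) x = 0 /\
  peval (tr3 n (elt_tens p a b q psi)) x = 0.
Proof.
move=> D0 na nn x0.
have B0 : peval (bary p a b) x = 0 by rewrite peval_bary x0 mul0r.
have dB := dird_bary_edge b na.
have ny : dotp n (coordv p) = (dotv n (vec b - vec p))%:C * bary p a b.
  by rewrite (dotp_bary _ D0) na rmorph0 mul0r add0r.
have dM w : dird (rot n) (bary p a b * w) = bary p a b * dird (rot n) w.
  by rewrite dirdM dB mul0r add0r.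
have dM2 w : dird (rot n) (bary p b a * bary p a b * w) = bary p a b * dird (rot n) (bary p b a * w).
  by rewrite -dM; congr (dird _ _); ring.
split; rewrite /elt_tens.
  rewrite bilinD bilin_symcurl bilin_yy dotp_elt_curl ny.
  by rewrite dM2 pevalD !pevalM B0; ring.
rewrite tr3D tr3_symcurl // tr3_yy dotp_elt_curl ny.
by rewrite dM2 dM [peval (_ + _) _]pevalD !pevalM B0; ring.
Qed.

Lemma area_apex p b : area p b p = 0. Proof. by rewrite /area; ring. Qed.
Lemma area_base p a : area p a a = 0. Proof. by rewrite /area; ring. Qed.

(** A B vanishes to second order at [p], and y vanishes there too. *)
Lemma elt_tens_vertex0 p a b q psi :
  map_mx (peval^~ p) (elt_tens p a b q psi) = 0.
Proof.
have A0 : peval (bary p b a) p = 0 by rewrite peval_bary area_apex mul0r.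
have B0 : peval (bary p a b) p = 0 by rewrite peval_bary area_apex mul0r.
have y0 i : peval (coordv p i 0) p = 0 by rewrite peval_coord subrr.
rewrite /elt_tens; apply: mx2P;
  rewrite mxE [RHS]mxE mxE pevalD ?symcurl00 ?symcurl01 ?symcurl10 ?symcurl11 scale_yyE !elt_curlE;
  by rewrite !(pdM, pdD, pdN) !(pevalD, pevalM, pevalN) A0 B0 !y0; ring.
Qed.

(** At [a] one has A = 1 and B = 0, so curl (A B psi) reduces to the product of psi(a) with curl B,
    and curl B is (a - p) / [area p b a]. The stated value of psi makes this cancel q(a) (a - p)(a -
    p)^T. *)
Lemma elt_tens_vertex p a b q psi : area p b a != 0 ->
  (forall i, peval (psi i 0) a = - area p b a * peval q a * (vec a i 0 - vec p i 0)) ->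
  map_mx (peval^~ a) (elt_tens p a b q psi) = 0.
Proof.
move=> D0 psia.
have A1 : peval (bary p b a) a = 1 by rewrite peval_bary divff.
have B0 : peval (bary p a b) a = 0 by rewrite peval_bary area_base mul0r.
have D0' : area p a b != 0 by rewrite areaC oppr_eq0.
rewrite /elt_tens; apply: mx2P;
  rewrite mxE [RHS]mxE mxE pevalD ?symcurl00 ?symcurl01 ?symcurl10 ?symcurl11 scale_yyE !elt_curlE;
  rewrite !(pdM, pdD, pdN) !(pd_bary0, pd_bary1) !(pevalD, pevalM, pevalN, pevalC) A1 B0;
  rewrite !peval_coord !psia ?vec0 ?vec1 [area p a b]areaC; field.
all: by rewrite ?D0 ?oppr_eq0.
Qed.

Lemma Sigma_locD l k c tau1 tau2 :
  Sigma_loc l k c tau1 -> Sigma_loc l k c tau2 -> Sigma_loc l k c (tau1 + tau2).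
Proof.
move=> [f1 [q1 [f1l q1k ->]]] [f2 [q2 [f2l q2k ->]]].
exists (f1 + f2), (q1 + q2); split.
- by move=> i; rewrite mxE; apply: deg_leD.
- exact: deg_leD.
rewrite scalerDl addrACA; congr (_ + _); apply: mx2P;
  rewrite mxE ?symcurl00 ?symcurl01 ?symcurl10 ?symcurl11 !mxE !pdD; ring.
Qed.

Lemma Sigma_loc0 l k c : Sigma_loc l k c (0 : 'M[poly2 R]_2).
Proof.
exists 0, 0; split => [i||]; rewrite ?mxE; try exact: deg_le0.
rewrite scale0r addr0; apply: mx2P;
  by rewrite ?symcurl00 ?symcurl01 ?symcurl10 ?symcurl11 !mxE !pd0; ring.
Qed.

(* [elt_tens] is centred at a vertex [p] instead of [c]; moving the centre changes
   the tensor by one of degree [k - 1], which [symcurl_decomp] covers. *)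
Lemma Sigma_loc_elt_tens l k c p a b q psi :
  (3 <= k)%N -> (k - 1 <= l)%N -> deg_le (k - 2) q -> (forall i, deg_le (l - 1) (psi i 0)) ->
  Sigma_loc l k c (elt_tens p a b q psi).
Proof.
case: k => [|[|[|m]]] // _; rewrite !subSS !subn0 => ml qm psil.
have l1 : (0 < l)%N by apply: leq_trans ml.
pose yy z : 'M[poly2 R]_2 := coordv z *m (coordv z)^T.
pose d i : poly2 R := (vec c i 0 - vec p i 0)%:C.
have yE i : coordv p i 0 = coordv c i 0 + d i by rewrite !coordE /d; ring.
have E0 i j : (q *: yy p - q *: yy c) i j =
    q * (coordv c i 0 * d j + d i * coordv c j 0 + d i * d j).
  rewrite -scalerBr mxE [X in _ * X]mxE [X in _ + X]mxE ![(coordv _ *m _) _ _]mxE !big_ord1. rewrite ![_^T _ _]mxE !yE; ring.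
have [||f [q' [fm q'm E]]] := @symcurl_decomp R c m (q *: yy p - q *: yy c).
- move=> i j; rewrite E0 (_ : m.+2 = (m.+1 + 1)%N); last by rewrite addn1.
  apply: deg_leM => //; apply: deg_leD; first apply: deg_leD.
  + by rewrite -[1%N]/(1 + 0)%N; apply: deg_leM (deg_le_coord _ _) (deg_leC _ _).
  + by rewrite -[1%N]/(0 + 1)%N; apply: deg_leM (deg_leC _ _) (deg_le_coord _ _).
  + by rewrite /d -rmorphM; apply: deg_leC.
- by rewrite !E0; ring.
rewrite /elt_tens -/(yy p) -[q *: yy p](subrK (q *: yy c)) E.
apply: Sigma_locD; last apply: Sigma_locD.
- exists (elt_curl p a b psi), 0; split; rewrite ?scale0r ?addr0 //; last exact: deg_le0.
  move=> i; rewrite elt_curlE (_ : l.+1 = 1 + 1 + (l - 1))%N; last by rewrite -addnA subnKC ?add1n.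
  by do !apply: deg_leM => //; apply: deg_le_bary.
- exists f, q'; split => // [i|].
    by apply: deg_le_trans (fm i); rewrite ltnS.
  by apply: deg_le_trans q'm; rewrite (leq_trans (leqnSn _)).
- exists 0, q; split => [i||]; rewrite ?mxE; try exact: deg_le0; first by [].
  rewrite -[LHS]add0r; congr (_ + _); apply: mx2P;
    by rewrite ?symcurl00 ?symcurl01 ?symcurl10 ?symcurl11 !mxE !pd0; ring.
Qed.

End Element.

(** * Antiderivatives and roots of univariate polynomials *)

Section Univariate.
Context {R : realType}.
Implicit Types P Q : {poly R}.

Lemma poly_ext P Q : (forall s, P.[s] = Q.[s]) -> P = Q.
Proof.
move=> H; apply/eqP; rewrite -subr_eq0; apply/eqP.
set S := P - Q; pose rs := [seq i%:R : R | i <- iota 0 (size S).+1].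
apply: (@roots_geq_poly_eq0 _ S rs).
- by apply/allP => _ /mapP[i _ ->]; rewrite /root hornerD hornerN H subrr.
- rewrite map_inj_uniq ?iota_uniq //; exact: mulrIn (oner_neq0 R).
- by rewrite size_map size_iota.
Qed.

(** At [i = 0] the division is by zero, whose inverse is 0, so this is the antiderivative vanishing
    at 0. *)
Definition antideriv P : {poly R} := \poly_(i < (size P).+1) (P`_i.-1 / i%:R).

Lemma coef_antideriv P i : (antideriv P)`_i.+1 = P`_i / i.+1%:R.
Proof.
rewrite coef_poly ltnS; case: ifP => // /negbT; rewrite -leqNgt => iP.
by rewrite nth_default ?mul0r.
Qed.

Lemma deriv_antideriv P : (antideriv P)^`() = P.
Proof.
apply/polyP => i; rewrite coef_deriv coef_antideriv -[_ *+ i.+1]mulr_natr divfK //.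
Qed.

Lemma antideriv0 P : (antideriv P).[0] = 0.
Proof. by rewrite horner_coef0 coef_poly invr0 mulr0. Qed.

Lemma size_antideriv P : (size (antideriv P) <= (size P).+1)%N.
Proof. exact: size_poly. Qed.

Lemma factor_01 P n : P.[0] = 0 -> P.[1] = 0 -> (size P <= n.+2)%N ->
  exists2 Q, P = 'X * (1 - 'X) * Q & (size Q <= n)%N.
Proof.
move=> P0 P1; have /factor_theorem[P' E] : root P 0 by apply/rootP.
have /factor_theorem[Q E'] : root P' 1.
  by apply/rootP; move: P1; rewrite E hornerM !hornerE subr0 mulr1.
rewrite {}E {P0 P1}E' => sP; exists (- Q).
  by rewrite polyC0 polyC1; ring.
rewrite size_polyN; have [->|Q0] := eqVneq Q 0; first by rewrite size_poly0.
move: sP; rewrite size_Mmonic ?monicXsubC ?mulf_neq0 ?polyXsubC_eq0 //.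
by rewrite size_Mmonic ?monicXsubC // !size_XsubC !addn2.
Qed.

End Univariate.

(** * Traces on the edge opposite to the centre, and tensors with prescribed traces *)

Section EdgeTraces.
Context {R : realType}.
Implicit Types (q : poly2 R) (P Q G : {poly R}) (psi : 'cV[poly2 R]_2).
Variables (p a b : R * R) (n : 'cV[R]_2) (L : R).
Hypotheses (D0 : area p b a != 0) (L0 : L != 0)
  (nn : n ord0 0 ^+ 2 + n ord_max 0 ^+ 2 = 1) (eL : vec b - vec a = L *: rot n).

Local Notation r := (restr a b).
(** On the edge from [a] to [b] the normal component of y is the constant [d], and at parameter s
    its tangential component is [at_ + L * s]. *)
Let d := dotv n (vec a - vec p).
Let at_ := dotv (rot n) (vec a - vec p).

Lemma restrD p1 p2 : r (p1 + p2) = r p1 + r p2. Proof. exact: rmorphD. Qed.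
Lemma restrM p1 p2 : r (p1 * p2) = r p1 * r p2. Proof. exact: rmorphM. Qed.

Lemma edge_end1 : b.1 = a.1 - L * n ord_max 0.
Proof. by move/matrixP/(_ ord0 0): eL; rewrite !mxE /=; lra. Qed.

Lemma edge_end2 : b.2 = a.2 + L * n ord0 0.
Proof. by move/matrixP/(_ ord_max 0): eL; rewrite !mxE /=; lra. Qed.

Lemma normal_offsetE : d = n ord0 0 * (a.1 - p.1) + n ord_max 0 * (a.2 - p.2).
Proof. by rewrite /d /dotv sum_ord2 !mxE. Qed.

Lemma tangent_offsetE : at_ = - n ord_max 0 * (a.1 - p.1) + n ord0 0 * (a.2 - p.2).
Proof. by rewrite /at_ /dotv sum_ord2 !mxE /=. Qed.

Lemma area_normal_offset : area p b a = L * d.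
Proof. by rewrite normal_offsetE /area edge_end1 edge_end2; ring. Qed.

Lemma normal_offset_neq0 : d != 0.
Proof. by move: D0; rewrite area_normal_offset mulf_eq0 negb_or => /andP[]. Qed.

Lemma restr_baryA : r (bary p b a) = 1 - 'X.
Proof.
apply: poly_ext => s; rewrite restrE peval_bary !hornerE.
by move: D0; rewrite /area /seg /= => ?; field; rewrite ?oppr_eq0.
Qed.

Lemma restr_baryB : r (bary p a b) = 'X.
Proof.
apply: poly_ext => s; rewrite restrE peval_bary !hornerE [X in _ / X]areaC.
by move: D0; rewrite /area /seg /= => ?; field; rewrite ?oppr_eq0.
Qed.

Lemma restr_dird q : r (dird (rot n) q) = L^-1%:P * (r q)^`().
Proof.
rewrite deriv_restr eL (_ : dird (L *: rot n) q = L%:C * dird (rot n) q).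
  by rewrite rmorphM /= restrC mulrA -polyCM mulVf // mul1r.
by rewrite !dirdE !mxE /= !rmorphM; ring.
Qed.

Lemma restr_dotp u psi : r (dotp u psi) =
  (u ord0 0)%:P * r (psi ord0 0) + (u ord_max 0)%:P * r (psi ord_max 0).
Proof. by rewrite /dotp rmorphD !rmorphM /= !restrC. Qed.

Lemma restr_normal_coord : r (dotp n (coordv p)) = d%:P.
Proof.
apply: poly_ext => s; rewrite restrE pevalD !pevalM !pevalC !peval_coord !vec0 !vec1.
by rewrite hornerC normal_offsetE /seg edge_end1 edge_end2 /=; ring.
Qed.

Lemma restr_tangent_coord : r (dotp (rot n) (coordv p)) = at_%:P + L%:P * 'X.
Proof.
apply: poly_ext => s; rewrite restrE pevalD !pevalM !pevalC !peval_coord !vec0 !vec1.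
rewrite !hornerE tangent_offsetE rot0 rot1 /seg edge_end1 edge_end2 /=.
apply/eqP; rewrite -subr_eq0 -[L in _ + L * s]mulr1 -[X in L * X * s]nn; apply/eqP; ring.
Qed.

(** On the edge A and B become [1 - 'X] and ['X], and the tangential derivative becomes [L^-1] times
    the derivative in the parameter. Prescribing the traces is thus an integration problem in one
    variable. *)
Lemma restr_bilin_elt q psi : r (bilin n n (elt_tens p a b q psi)) =
  L^-1%:P * ('X * (1 - 'X) * r (dotp n psi))^`() + (d ^+ 2)%:P * r q.
Proof.
rewrite /elt_tens bilinD bilin_symcurl bilin_yy dotp_elt_curl rmorphD /= restr_dird.
rewrite !rmorphM /= restr_baryA restr_baryB restr_normal_coord.
rewrite ['X * _]mulrC; congr (_ + _); ring.
Qed.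

Lemma restr_tr3_elt q psi : r (tr3 n (elt_tens p a b q psi)) =
  (L^-1 ^+ 2)%:P * ('X * (1 - 'X) * r (dotp (rot n) psi))^`()^`() +
  d%:P * (L^-1%:P * (r q * (at_%:P + L%:P * 'X))^`() + r (euler p q) + 3%:R * r q).
Proof.
rewrite /elt_tens tr3D tr3_symcurl // tr3_yy dotp_elt_curl restrD !restr_dird.
rewrite [r (bary p b a * _ * _)]restrM [r (bary p b a * _)]restrM restr_baryA restr_baryB.
rewrite [r (dotp n _ * _)]restrM restr_normal_coord.
rewrite [r (_ + 3%:R%:C * q)]restrD [r (_ + euler p q)]restrD restr_dird.
rewrite [r (q * _)]restrM restr_tangent_coord.
rewrite [r (3%:R%:C * q)]restrM restrC polyC_natr.
congr (_ + _); rewrite ['X * _]mulrC; move: (_ * r _) => S.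
by rewrite derivM derivC mul0r add0r mulrA -polyCM.
Qed.

(** The bubble term has degree at most l + 1 on the edge; it is differentiated once in the first
    trace and twice in the second. The bounds are those that [elt_extension] asks of [G2] and
    [G3]. *)
Lemma size_elt_data l q psi : (0 < l)%N ->
  deg_le (l - 1) q -> (forall i, deg_le (l - 1) (psi i 0)) ->
  (size (r (bilin n n (elt_tens p a b q psi))) <= l.+1)%N /\
  (size (r (tr3 n (elt_tens p a b q psi))) <= l)%N.
Proof.
case: l => // l _; rewrite subSS subn0 => ql psil.
have szC (u : R) P m : (size P <= m)%N -> (size (u%:P * P)%R <= m)%N.
  by move=> Pm; rewrite mul_polyC (leq_trans (size_scale_leq _ _)).
have szD P Q m : (size P <= m)%N -> (size Q <= m)%N -> (size (P + Q)%R <= m)%N.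
  by move=> Pm Qm; rewrite (leq_trans (size_polyD _ _)) // geq_max Pm.
have szd P m : (size P <= m.+1)%N -> (size P^`() <= m)%N.
  move=> Pm; apply/leq_sizeP => j mj; rewrite coef_deriv nth_default ?mul0rn //.
  exact: leq_trans Pm _.
have szdp u : (size (r (dotp u psi)) <= l.+1)%N.
  by rewrite restr_dotp; apply: (szD); apply: (szC); apply: size_restr.
have szM P Q m m' : (size P <= m.+1)%N -> (size Q <= m')%N -> (size (P * Q)%R <= m + m')%N.
  move=> Pm Qm; apply: leq_trans (size_polyMleq _ _) _; rewrite -subn1 leq_subLR.
  by rewrite addnA add1n; apply: leq_add.
have sz3 u : (size ('X * (1 - 'X) * r (dotp u psi))%R <= l.+3)%N.
  apply: ((szM) _ _ 2%N l.+1) => //.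
  apply: ((szM) _ _ 1%N 2%N); first by rewrite size_polyX.
  by apply: (szD); rewrite ?size_polyN ?size_polyX ?size_poly1.
split.
  rewrite restr_bilin_elt; apply: (szD); apply: (szC); first exact: szd.
  by apply: leq_trans (size_restr _ _ ql) _.
rewrite restr_tr3_elt; apply: (szD); apply: (szC); first by do 2 apply: (szd).
apply: (szD); first apply: (szD).
- apply: (szC); apply: (szd); rewrite mulrC; apply: ((szM) _ _ 1%N l.+1); last exact: size_restr.
  apply: (szD); first by rewrite (leq_trans (size_polyC_leq1 _)).
  by apply: (szC); rewrite size_polyX.
- by apply: size_restr; apply: deg_le_euler.
- by rewrite -polyC_natr; apply: (szC); apply: size_restr.
Qed.

(** The composition of [P] with [A]. Since [bary p a b] restricts to the edge parameter, it extends
    a polynomial from the edge to the plane without raising its degree. *)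
Definition lift_poly P (A : poly2 R) : poly2 R := \sum_(i < size P) (P`_i)%:C * A ^+ i.

Lemma peval_lift P A x : peval (lift_poly P A) x = P.[peval A x].
Proof.
rewrite horner_coef /peval /lift_poly rmorph_sum; apply: eq_bigr => i _.
by rewrite /= rmorphM rmorphXn /= mpoly.mevalC.
Qed.

Lemma deg_le_lift m P A : deg_le 1 A -> (size P <= m.+1)%N -> deg_le m (lift_poly P A).
Proof.
move=> A1 Pm; rewrite /lift_poly; apply: (big_ind (deg_le m)) => [||i _].
- exact: deg_le0.
- exact: deg_leD.
have im : (i <= m)%N by rewrite -ltnS (leq_trans (ltn_ord i)).
apply: deg_le_trans im _; rewrite -[X in deg_le X]add0n; apply: deg_leM (deg_leC _ _) _.
elim: (nat_of_ord i) => [|j IH]; first by rewrite expr0 -(mpoly.mpolyC1 2); apply: deg_leC.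
by rewrite exprS -add1n; apply: deg_leM.
Qed.

Lemma restr_lift P : r (lift_poly P (bary p a b)) = P.
Proof.
by apply: poly_ext => s; rewrite restrE peval_lift -restrE restr_baryB hornerX.
Qed.

Lemma euler_bary (p1 b1 a1 : R * R) : euler p1 (bary p1 b1 a1) = bary p1 b1 a1.
Proof. by rewrite eulerE pd_bary0 pd_bary1 /bary -lock !rmorphM rmorphN /=; ring. Qed.

Lemma split_normal_a i : vec a i 0 - vec p i 0 = d * n i 0 + at_ * rot n i 0.
Proof.
rewrite normal_offsetE tangent_offsetE -[LHS]mulr1 -nn.
by case: (ord2P i) => ->; rewrite ?rot0 ?rot1 ?vec0 ?vec1; ring.
Qed.

Lemma split_normal_b i : vec b i 0 - vec p i 0 = d * n i 0 + (at_ + L) * rot n i 0.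
Proof.
rewrite mulrDl addrA -split_normal_a.
by case: (ord2P i) => ->; rewrite ?rot0 ?rot1 ?vec0 ?vec1 ?edge_end1 ?edge_end2; ring.
Qed.

(* On the edge from [a] to [b], parametrized by [0, 1], put
   [Phi = 'X (1 - 'X) psi], [D = L d] and [F = Phi' + D q y], with [y] the position
   relative to [p].  Prescribing both traces means [F_n = L G2] and
   [F_t' = L^2 G3 - D L (4 q - qp)], and the tensor vanishes at [a] and [b] iff
   [F] does.  The values [qa], [qb], [qp] of the affine function [q] at the
   vertices are determined by [F_t(1) = 0] and [Phi(1) = 0]. *)
Lemma elt_extension l G2 G3 : (2 <= l)%N ->
  (size G2 <= l.+1)%N -> G2.[0] = 0 -> G2.[1] = 0 -> (size G3 <= l)%N ->
  exists q psi, [/\ deg_le 1 q, forall i, deg_le (l - 1) (psi i 0),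
    map_mx (peval^~ a) (elt_tens p a b q psi) = 0,
    map_mx (peval^~ b) (elt_tens p a b q psi) = 0 &
    r (bilin n n (elt_tens p a b q psi)) = G2 /\ r (tr3 n (elt_tens p a b q psi)) = G3].
Proof.
move=> l2 sG2 G20 G21 sG3.
have prim P : exists P', [/\ P'^`() = P, P'.[0] = 0 & (size P' <= (size P).+1)%N].
  exists (antideriv P).
  by rewrite deriv_antideriv antideriv0 size_antideriv.
have [A2 [dA2 A20 sA2]] := prim G2; have [A3 [dA3 A30 sA3]] := prim G3.
have [B3 [dB3 B30 sB3]] := prim A3.
have d0 := normal_offset_neq0.
(* In this order the equations express Phi_n(1) = 0, F_t(1) = 0 and Phi_t(1) = 0. *)
have [qa [qb [qp [E1 E2 E3]]]] : exists qa qb qp, [/\ A2.[1] = d ^+ 2 * (qa + qb) / 2,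
    A3.[1] = d * (2 * (qa + qb) - qp) &
    B3.[1] = d * (at_ * (qa + qb) / (2 * L) + qa / 2 + (qa + qb) - qp / 2)].
  (* The system is triangular: the first equation gives [S], the sum of [qa] and [qb], the second
     then gives [qp], and the third [qa]. *)
  pose S := 2 * A2.[1] / d ^+ 2.
  pose qp := 2 * S - A3.[1] / d.
  pose qa := 2 * (B3.[1] / d - at_ * S / (2 * L) - S + qp / 2).
  by exists qa, (S - qa), qp; split; rewrite /qa /qp /S; field; rewrite ?L0 ?d0.
(* [Fn] and [Ft] are the components of Phi, not of F: the antiderivatives of those of F - D q y that
   vanish at 0. *)
pose Fn := L%:P * A2 - (L * d ^+ 2)%:P * (qa%:P * 'X + ((qb - qa) / 2)%:P * 'X ^+ 2).
pose Ft := (L ^+ 2)%:P * B3 -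
  (d * L ^+ 2)%:P * ((2 * qa)%:P * 'X ^+ 2 + (2 * (qb - qa) / 3)%:P * 'X ^+ 3 - (qp / 2)%:P * 'X ^+ 2) -
  (L * d)%:P * ((qa * at_)%:P * 'X + ((qa * L + (qb - qa) * at_) / 2)%:P * 'X ^+ 2 +
                ((qb - qa) * L / 3)%:P * 'X ^+ 3).
have dFn : Fn^`() = L%:P * G2 - (L * d ^+ 2)%:P * (qa%:P + (qb - qa)%:P * 'X).
  by apply: poly_ext => s; rewrite /Fn !(derivD, derivN, derivM, derivC, derivX, derivXn) dA2 !hornerE /=; field.
have dFt : Ft^`() = (L ^+ 2)%:P * A3 -
    (d * L ^+ 2)%:P * ((4 * qa)%:P * 'X + (2 * (qb - qa))%:P * 'X ^+ 2 - qp%:P * 'X) -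
    (L * d)%:P * ((qa%:P + (qb - qa)%:P * 'X) * (at_%:P + L%:P * 'X)).
  by apply: poly_ext => s; rewrite /Ft !(derivD, derivN, derivM, derivC, derivX, derivXn) dB3 !hornerE /=; field.
have Fn0 : Fn.[0] = 0 by rewrite /Fn !hornerE /= A20; ring.
have Ft0 : Ft.[0] = 0 by rewrite /Ft !hornerE /= B30; ring.
have Fn1 : Fn.[1] = 0 by rewrite /Fn !hornerE /= E1; field.
have Ft1 : Ft.[1] = 0.
  by rewrite /Ft !hornerE /= E3; field.
have szC (u : R) P m : (size P <= m)%N -> (size (u%:P * P)%R <= m)%N.
  by move=> Pm; rewrite mul_polyC (leq_trans (size_scale_leq _ _)).
have szB P Q m : (size P <= m)%N -> (size Q <= m)%N -> (size (P - Q)%R <= m)%N.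
  by move=> Pm Qm; rewrite (leq_trans (size_polyD _ _)) // geq_max Pm size_polyN.
have szD P Q m : (size P <= m)%N -> (size Q <= m)%N -> (size (P + Q)%R <= m)%N.
  by move=> Pm Qm; rewrite (leq_trans (size_polyD _ _)) // geq_max Pm.
(* The cubic terms have size 4, which fits below [l.+2] because [2 <= l]. *)
have sX i : (i <= 3)%N -> (size ('X ^+ i : {poly R}) <= l.+2)%N.
  by move=> i3; rewrite size_polyXn (leq_trans (_ : _ <= 4)%N) // !ltnS.
have sX1 : (size ('X : {poly R}) <= l.+2)%N by rewrite size_polyX.
have [|Pn En sPn] := factor_01 (n := l) Fn0 Fn1.
  apply: (szB); first by apply: (szC); apply: leq_trans sA2 _.
  by apply: (szC); apply: (szD); apply: (szC) => //; apply: sX.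
have [|Pt Et sPt] := factor_01 (n := l) Ft0 Ft1.
  apply: (szB); first apply: (szB).
  - apply: (szC); apply: leq_trans sB3 _; rewrite ltnS.
    exact: leq_trans sA3 _.
  - by apply: (szC); apply: (szB); first apply: (szD); apply: (szC); apply: sX.
  - by apply: (szC); apply: (szD); first apply: (szD); apply: (szC) => //; apply: sX.
pose B := bary p a b.
pose q := qp%:C + (qa - qp)%:C * bary p b a + (qb - qp)%:C * B.
pose psi : 'cV[poly2 R]_2 := \col_i ((n i 0)%:C * lift_poly Pn B + (rot n i 0)%:C * lift_poly Pt B).
have psiE i : psi i 0 = (n i 0)%:C * lift_poly Pn B + (rot n i 0)%:C * lift_poly Pt B by rewrite mxE.
have rq : r q = qa%:P + (qb - qa)%:P * 'X.
  by rewrite /q /B !restrD !restrM !restrC restr_baryA restr_baryB !polyCB; ring.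
have B0 : euler p B = B := euler_bary p a b.
have A0 := euler_bary p b a.
(* [q - qp] is homogeneous of degree 1 about [p]; this turns the term [euler p q + 3 q] of the
   second trace into 4 q - qp. *)
have eq : euler p q = q - qp%:C.
  by rewrite /q !eulerD !eulerZ A0 B0 [euler p _%:C]eulerE !pdC; ring.
have nnP P : ((n ord0 0)%:P ^+ 2 + (n ord_max 0)%:P ^+ 2) * P = P.
  by rewrite -!rmorphXn -rmorphD nn mul1r.
have rpsin : r (dotp n psi) = Pn.
  rewrite restr_dotp !psiE !restrD !restrM !restrC !restr_lift rot0 rot1 -[RHS]nnP polyCN; ring.
have rpsit : r (dotp (rot n) psi) = Pt.
  rewrite restr_dotp !psiE !restrD !restrM !restrC !restr_lift rot0 rot1 -[RHS]nnP polyCN; ring.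
(* At the ends Phi' equals psi(0) and -psi(1). As F vanishes there, psi takes the values required by
   [elt_tens_vertex]. *)
have P0 (P : {poly R}) : ('X * (1 - 'X) * P)^`().[0] = P.[0].
  by rewrite !(derivD, derivN, derivM, derivC, derivX) !hornerE /=; ring.
have P1 (P : {poly R}) : ('X * (1 - 'X) * P)^`().[1] = - P.[1].
  by rewrite !(derivD, derivN, derivM, derivC, derivX) !hornerE /=; ring.
have Pn0 : Pn.[0] = - (L * d * qa) * d.
  by rewrite -P0 -En dFn !hornerE G20 /=; ring.
have Pt0 : Pt.[0] = - (L * d * qa) * at_.
  by rewrite -P0 -Et dFt !hornerE A30 /=; ring.
have Pn1 : Pn.[1] = L * d * qb * d.
  by rewrite -[LHS]opprK -P1 -En dFn !hornerE G21 /=; ring.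
have Pt1 : Pt.[1] = L * d * qb * (at_ + L).
  by rewrite -[LHS]opprK -P1 -Et dFt !hornerE /= E2; ring.
exists q, psi; split.
- have d0A (u : R) A : deg_le 1 A -> deg_le 1 (u%:C * A) by exact: deg_leM (deg_leC 0 _).
  by do ![apply: deg_leD]; [apply: deg_leC|apply: d0A; apply: deg_le_bary..].
- move=> i; rewrite psiE; case: l l2 sPn sPt {sG2 sG3 sX sX1} => // l _ sPn sPt; rewrite subSS subn0.
  by apply: deg_leD; rewrite -[l]add0n; apply: deg_leM (deg_leC _ _) _;
     apply: deg_le_lift (deg_le_bary _ _ _) _.
- apply: elt_tens_vertex => // i; rewrite psiE /q !(pevalD, pevalM, pevalC) !peval_lift.
  rewrite !peval_bary divff // area_base mul0r Pn0 Pt0 split_normal_a area_normal_offset; ring.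
- have D1 : area p a b != 0 by rewrite areaC oppr_eq0.
  rewrite elt_tensC; apply: elt_tens_vertex => // i.
  rewrite psiE /q !(pevalD, pevalM, pevalC) !peval_lift.
  rewrite !peval_bary divff // area_base mul0r Pn1 Pt1 split_normal_b areaC area_normal_offset; ring.
split.
- rewrite restr_bilin_elt rpsin -En dFn rq; apply: poly_ext => s; rewrite !hornerE /=; field.
  by rewrite L0.
- rewrite restr_tr3_elt rpsit -Et dFt eq restrD rmorphN /= restrC rq.
  apply: poly_ext => s; rewrite !(derivD, derivN, derivM, derivC, derivX, derivXn) dA3 !hornerE /=.
  by field; rewrite L0.
Qed.

End EdgeTraces.

(** * Integrals over elements *)

Section Integration.
Context {R : realType}.
Implicit Types (p q : poly2 R) (A : set (R * R)).

Lemma measurable_peval p : measurable_fun setT (fun x : R * R => peval p x).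
Proof.
elim/(@poly2_ind R): p => [u|i|p q Hp Hq|p q Hp Hq].
- by under eq_fun do rewrite pevalC; exact: measurable_cst.
- under eq_fun do rewrite pevalX.
  case: (ord2P i) => ->; [under eq_fun do rewrite vec0|under eq_fun do rewrite vec1].
  + exact: measurable_fst.
  + exact: measurable_snd.
- by under eq_fun do rewrite pevalD; exact: measurable_realfun.measurable_funD.
- by under eq_fun do rewrite pevalM; exact: measurable_realfun.measurable_funM.
Qed.

Lemma continuous_peval p : continuous (fun x : R * R => peval p x).
Proof.
elim/(@poly2_ind R): p => [u|i|p q Hp Hq|p q Hp Hq] x.
- by under eq_fun do rewrite pevalC; exact: cvg_cst.
- case: (ord2P i) => ->.
  + rewrite (_ : [eta peval _] = fst); first exact: cvg_fst.
    by apply/funext => y; rewrite pevalX vec0.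
  + rewrite (_ : [eta peval _] = snd); first exact: cvg_snd.
    by apply/funext => y; rewrite pevalX vec1.
- by under eq_fun do rewrite pevalD; apply: cvgD; [exact: Hp|exact: Hq].
- by under eq_fun do rewrite pevalM; apply: cvgM; [exact: Hp|exact: Hq].
Qed.

Lemma bounded_peval (C : R) p : exists M : R, forall x : R * R,
  `|x.1| <= C -> `|x.2| <= C -> `|peval p x| <= M.
Proof.
elim/(@poly2_ind R): p => [u|i|p q [M Hp] [N Hq]|p q [M Hp] [N Hq]].
- by exists `|u| => x _ _; rewrite pevalC.
- by exists C => x *; rewrite pevalX; case: (ord2P i) => ->; rewrite ?vec0 ?vec1.
- exists (M + N) => x x1 x2; rewrite pevalD (le_trans (ler_normD _ _)) //.
  by apply: lerD; [apply: Hp|apply: Hq].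
- exists (M * N) => x x1 x2; rewrite pevalM normrM.
  by apply: ler_pM; rewrite ?normr_ge0 //; [apply: Hp|apply: Hq].
Qed.

Definition box (C : R) : set (R * R) := `[- C, C]%classic `*` `[- C, C]%classic.

Lemma boxE C x : box C x <-> `|x.1| <= C /\ `|x.2| <= C.
Proof. by rewrite /box /= !in_itv /= !ler_norml; split=> -[]. Qed.

Lemma mu2_itv_prod (I J : interval R) : mu2 ([set` I] `*` [set` J]) =
  (lebesgue_measure [set` I] * lebesgue_measure [set` J])%E.
Proof. by apply: product_measure1E. Qed.

Lemma mu2_box (C : R) : (mu2 (box C) < +oo)%E.
Proof.
rewrite /box mu2_itv_prod lebesgue_measure_itv /=.
by case: ifP => _; rewrite ?mule0 // -EFinB -EFinM ltry.
Qed.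

Lemma integrable_peval A C p : measurable A -> A `<=` box C ->
  mu2.-integrable A (EFin \o peval p).
Proof.
move=> mA AC; apply: measurable_bounded_integrable => //.
- apply: le_lt_trans (mu2_box C); apply: le_measure; rewrite ?inE //.
  by rewrite /box; apply: measurableX; exact: measurable_itv.
- exact: measurable_funTS (measurable_peval p).
have [M HM] := bounded_peval C p.
exists M; split => [|y My]; first exact: num_real.
by move=> x /AC /boxE[x1 x2] /=; apply: le_trans (ltW My); apply: HM.
Qed.

Lemma Rintegral_peval_gt0 A C p (x0 : R * R) : measurable A -> A `<=` box C ->
  nbhs x0 A -> (forall x, 0 <= peval p x) -> 0 < peval p x0 ->
  0 < \int[mu2]_(x in A) peval p x.
Proof.
move=> mA AC x0A p0 px0; set e := peval p x0 / 2.
have e0 : 0 < e by rewrite divr_gt0.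
have : nbhs x0 (A `&` [set x | e < peval p x]).
  apply: filterI => //; apply: (@continuous_peval p x0 [set y | e < y]).
  by apply: lt_nbhsr; rewrite /e ltr_pdivrMr // mulr_natr mulr2n ltrDl.
move=> /nbhs_ballP[d /= d0 dB].
pose B : set (R * R) := `](x0.1 - d), (x0.1 + d)[%classic `*` `](x0.2 - d), (x0.2 + d)[%classic.
have BA : B `<=` A `&` [set x | e < peval p x].
  move=> [x y] [/=]; rewrite !in_itv /= => x1 x2; apply: dB.
  by split; rewrite /ball /= ltr_distlC.
have mB : measurable B by apply: measurableX; exact: measurable_itv.
have BA1 : B `<=` A by move=> x /BA[].
(* [fine] sends [+oo] to 0, so a positive real integral requires finiteness as well as positivity of
   the extended one. *)
rewrite /Rintegral fine_gt0 //; apply/andP; split; last first.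
  have /integrableP[_] := integrable_peval p mA AC.
  apply: le_lt_trans; rewrite le_eqVlt; apply/orP; left; apply/eqP.
  by apply: eq_integral => x _ /=; rewrite ger0_norm.
have mBpos : (0 < mu2 B)%E.
  rewrite /B mu2_itv_prod !lebesgue_measure_itv /= !lte_fin !ltrBlDr -!addrA !ltrDl addr_gt0 //=.
  by rewrite -!EFinB -EFinM lte_fin; apply: mulr_gt0; lra.
apply: lt_le_trans (_ : \int[mu2]_(x in B) e%:E <= _)%E.
  by rewrite integral_cst // mule_gt0.
apply: le_trans (_ : \int[mu2]_(x in B) (peval p x)%:E <= _)%E.
  apply: ge0_le_integral => //.
  - by move=> x _; rewrite lee_fin ltW.
  - by apply/measurable_realfun.measurable_EFinP; exact: measurable_funTS (measurable_peval p).
  - by move=> x /BA[_ /ltW].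
apply: ge0_subset_integral => //.
  by apply/measurable_realfun.measurable_EFinP; exact: measurable_funTS (measurable_peval p).
by move=> x _; rewrite lee_fin.
Qed.

End Integration.

(** * Polynomials vanishing near a point *)

Section Vanishing.
Context {R : realType}.
Implicit Types (p : poly2 R) (P : {poly R}).

Lemma poly_eq0_near P (d : R) : 0 < d -> (forall s, 0 < s <= d -> P.[s] = 0) -> P = 0.
Proof.
move=> d0 H; pose rs := [seq d / i.+1%:R : R | i <- iota 0 (size P).+1].
apply: (@roots_geq_poly_eq0 _ P rs).
- apply/allP => _ /mapP[i _ ->]; rewrite /root H // divr_gt0 ?ltr0n //=.
  by rewrite ler_pdivrMr ?ltr0n // ler_peMr ?ler1n // ltW.
- rewrite map_inj_uniq ?iota_uniq // => i j /(mulfI (lt0r_neq0 d0)) /invr_inj /eqP.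
  by rewrite eqr_nat => /eqP[].
- by rewrite size_map size_iota.
Qed.

Lemma pd_eq0_const p : (forall i, pd i p = 0) -> p = (mpoly.mcoeff mpoly.mnm0 p)%:C.
Proof.
move=> H; apply/mpoly.mpolyP => m; rewrite mpoly.mcoeffC.
case: (eqVneq m mpoly.mnm0) => [->|m0]; first by rewrite mulr1.
rewrite mulr0; have [i mi] : exists i, (0 < m i)%N.
  apply/existsP; apply: contraR m0 => /existsPn m0; apply/eqP/mpoly.mnmP => i.
  by rewrite mpoly.mnm0E; apply/eqP; rewrite eqn0Ngt m0.
have := mpoly.mcoeff_deriv i (mpoly.mnm_sub m (mpoly.mnm1 i)) p.
rewrite -/(pd i p) H mpoly.mcoeff0 mpoly.submK ?mpoly.lep1mP -?lt0n //.
by move=> /esym/eqP; rewrite mulrn_eq0 => /eqP.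
Qed.

Lemma peval_inj0 p : (forall x, peval p x = 0) -> p = 0.
Proof.
move: {2}(mpoly.msize p) (leqnn (mpoly.msize p)) => n.
elim: n p => [|n IH] p pn p0.
  by apply/eqP; rewrite -mpoly.msize_poly_eq0 -leqn0.
have pd0 i : pd i p = 0.
  apply: IH => [|x]; first exact: msize_pd.
  pose e : R * R := (x.1 + (i == ord0)%:R, x.2 + (i == ord_max)%:R).
  have r0 : restr x e p = 0.
    by apply: poly_ext => s; rewrite restrE p0 hornerC.
  have := deriv_restr x e p; rewrite r0 derivC => /(congr1 (horner^~ 0)).
  rewrite restrE hornerC (_ : seg x e 0 = x); last first.
    by case: (x) => u v; rewrite /seg /= !mul0r !subr0 !mul1r !addr0.
  rewrite dirdE pevalD !pevalM !pevalC !mxE /=.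
  by case: (ord2P i) => -> /=; rewrite !addr0 !subrr addrAC subrr add0r mul0r mul1r ?addr0 ?add0r.
rewrite (pd_eq0_const pd0); have := p0 (0, 0).
by rewrite {1}(pd_eq0_const pd0) pevalC => ->; rewrite mpoly.mpolyC0.
Qed.

(** Along the segment from [x0] to any [y], the restriction vanishes for small positive parameters,
    hence identically, and in particular at [y]. *)
Lemma peval_eq0_near p (x0 : R * R) : (\forall x \near x0, peval p x = 0) -> p = 0.
Proof.
move=> /nbhs_ballP[d /= d0 dB]; apply: peval_inj0 => y.
pose m := 1 + `|y.1 - x0.1| + `|y.2 - x0.2|.
have m0 : 0 < m by rewrite /m -addrA ltr_pwDl // addr_ge0.
suff r0 : restr x0 y p = 0.
  have <- : seg x0 y 1 = y by case: (y) => u v; rewrite /seg /= subrr !mul0r !add0r !mul1r.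
  by rewrite -restrE r0 hornerC.
apply: (@poly_eq0_near _ (d / m)) => [|s /andP[s0 sd]]; first by rewrite divr_gt0.
have sm : s * m <= d by rewrite -ler_pdivlMr.
have lt1 u : `|u| < m -> `|s * u| < d.
  move=> um; rewrite normrM gtr0_norm //; apply: lt_le_trans sm.
  by rewrite ltr_pM2l.
have y1 : `|y.1 - x0.1| < m by rewrite /m; have := normr_ge0 (y.2 - x0.2); lra.
have y2 : `|y.2 - x0.2| < m by rewrite /m; have := normr_ge0 (y.1 - x0.1); lra.
rewrite restrE; apply: dB; split; rewrite /seg /ball /=.
- by rewrite (_ : _ - _ = - (s * (y.1 - x0.1))); [rewrite normrN; exact: lt1|ring].
- by rewrite (_ : _ - _ = - (s * (y.2 - x0.2))); [rewrite normrN; exact: lt1|ring].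
Qed.

Lemma Rintegral_peval_eq0 (A : set (R * R)) C p (x0 : R * R) : measurable A -> A `<=` box C ->
  nbhs x0 A -> (forall x, 0 <= peval p x) -> \int[mu2]_(x in A) peval p x = 0 -> p = 0.
Proof.
move=> mA AC nA p0 ip; apply: (@peval_eq0_near _ x0).
have : \forall x \near x0, nbhs x A by apply: nbhs_interior.
apply: filterS => x nx; apply/eqP; rewrite eq_le p0 andbT leNgt; apply/negP => px.
by have := Rintegral_peval_gt0 mA AC nx p0 px; rewrite ip ltxx.
Qed.

End Vanishing.

(** * Triangles as sets defined by barycentric inequalities *)

Section Triangle.
Context {R : realType}.
Variables (p a b : R * R).
Hypothesis D0 : area p b a != 0.

(** Three polynomial inequalities give measurability and an interior point directly; [hull_triangle]
    carries both over to the elements. *)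
Definition triangle : set (R * R) :=
  [set x | [/\ 0 <= peval (bary p b a) x, 0 <= peval (bary p a b) x &
               0 <= peval (1 - (bary p b a + bary p a b)) x] ].

Lemma measurable_triangle : measurable triangle.
Proof.
have m q : measurable [set x : R * R | 0 <= peval q x].
  rewrite (_ : [set x | _] = setT `&` (peval q) @^-1` `[0, +oo[%classic).
    by apply: (measurable_peval q) => //; exact: measurable_itv.
  by apply/seteqP; split => x /=; rewrite in_itv /= andbT //; case.
rewrite (_ : triangle = [set x | 0 <= peval (bary p b a) x] `&`
  [set x | 0 <= peval (bary p a b) x] `&` [set x | 0 <= peval (1 - (bary p b a + bary p a b)) x]).
  by do !apply: measurableI.
by apply/seteqP; split => x /= []; [|case].
Qed.

Lemma triangle_combination x : x =
  (peval (bary p b a) x * a.1 + peval (bary p a b) x * b.1 +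
     peval (1 - (bary p b a + bary p a b)) x * p.1,
   peval (bary p b a) x * a.2 + peval (bary p a b) x * b.2 +
     peval (1 - (bary p b a + bary p a b)) x * p.2).
Proof.
rewrite !(pevalD, pevalN) peval1 !peval_bary [area p a b]areaC.
case: x => u v; congr (_, _); move: D0; rewrite /area /= => H; field; exact: H.
Qed.

Lemma bary_combination (s t w : R) x : s + t + w = 1 ->
  x = (s * a.1 + t * b.1 + w * p.1, s * a.2 + t * b.2 + w * p.2) ->
  peval (bary p b a) x = s /\ peval (bary p a b) x = t.
Proof.
move=> stw; have -> : w = 1 - s - t by rewrite -stw; ring.
move=> ->; rewrite !peval_bary [area p a b]areaC.
move: D0; rewrite /area /= => H; split; field; exact: H.
Qed.

Lemma triangle_bounded : exists C, triangle `<=` box C.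
Proof.
exists (`|a.1| + `|a.2| + `|b.1| + `|b.2| + `|p.1| + `|p.2|) => x [].
rewrite !(pevalD, pevalN) peval1.
have := triangle_combination x; rewrite !(pevalD, pevalN) peval1.
move: (peval _ x) (peval _ x) => s t -> s0 t0 w0.
have scale_le (c u : R) : 0 <= c -> c <= 1 -> `|c * u| <= `|u|.
  by move=> c0 c1; rewrite normrM ger0_norm // ler_piMl.
have key (u v w : R) : `|t * u + s * v + (1 - (t + s)) * w| <= `|u| + `|v| + `|w|.
  apply: le_trans (ler_normD _ _) _; apply: lerD; last by apply: scale_le => //; lra.
  by apply: le_trans (ler_normD _ _) _; apply: lerD; apply: scale_le => //; lra.
apply/boxE; split => /=; apply: le_trans (key _ _ _) _.
- have := normr_ge0 a.2; have := normr_ge0 b.2; have := normr_ge0 p.2; lra.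
- have := normr_ge0 a.1; have := normr_ge0 b.1; have := normr_ge0 p.1; lra.
Qed.

Lemma triangle_interior : exists x0 : R * R, nbhs x0 triangle.
Proof.
exists ((a.1 + b.1 + p.1) / 3, (a.2 + b.2 + p.2) / 3); set x0 := (_, _).
have [A0 B0] : peval (bary p b a) x0 = 3^-1 /\ peval (bary p a b) x0 = 3^-1.
  by apply: (@bary_combination _ _ 3^-1); [field|congr (_, _); field].
have H q : 0 < peval q x0 -> \forall x \near x0, 0 <= peval q x.
  move=> q0; have : \forall x \near x0, 0 < peval q x.
    by apply: (@continuous_peval _ q x0 [set y | 0 < y]); apply: lt_nbhsr.
  by apply: filterS => x /ltW.
have HA : \forall x \near x0, 0 <= peval (bary p b a) x by apply: H; rewrite A0.
have HB : \forall x \near x0, 0 <= peval (bary p a b) x by apply: H; rewrite B0.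
have HC : \forall x \near x0, 0 <= peval (1 - (bary p b a + bary p a b)) x.
  by apply: H; rewrite pevalD pevalN pevalD A0 B0 peval1; lra.
near=> x; split; near: x; assumption.
Unshelve. all: by end_near.
Qed.

End Triangle.

(** * Geometry of the mesh *)

Section MeshGeometry.
Context {R : realType} (M : mesh R).
Local Notation I := 'I_(nnode M).
Local Notation x_ := (@node R M).
Implicit Types (i j c : I) (K : {set I}).

Lemma elt_vertices K i j : #|K| = 3%N -> i \in K -> j \in K -> i != j ->
  exists c, [/\ K = [set i; j; c]%SET, c != i & c != j].
Proof.
move=> K3 iK jK ij.
have : #|K :\ i :\ j| = 1%N.
  have jKi : j \in K :\ i by rewrite !inE eq_sym ij jK.
  by move: K3; rewrite (cardsD1 i) iK (cardsD1 j (K :\ i)) jKi => -[].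
move=> /eqP/cards1P[c Ec]; exists c.
have cK : c \in K :\ i :\ j by rewrite Ec set11.
move: cK; rewrite !inE => /and3P[cj ci cK]; split => //.
apply/setP => m; have := Ec => /setP/(_ m); rewrite !inE.
case: (eqVneq m i) => [->|mi]; first by rewrite iK.
by case: (eqVneq m j) => [->|mj] /=; first rewrite jK.
Qed.

Definition weight3 i j c (s t w : R) m : R :=
  if m == i then s else if m == j then t else if m == c then w else 0.

Lemma sum_weight3 i j c s t w (f : I -> R) : j != i -> c != i -> c != j ->
  \sum_m weight3 i j c s t w m * f m = s * f i + t * f j + w * f c.
Proof.
move=> ji ci cj; rewrite (bigD1 i) //= (bigD1 j) //= (bigD1 c) /=; last by rewrite ci.
rewrite big1 ?addr0 => [|m /andP[/andP[mi mj] mc]]; rewrite /weight3.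
  by rewrite eqxx (negbTE ji) eqxx (negbTE ci) (negbTE cj) eqxx addrA.
by rewrite (negbTE mi) (negbTE mj) (negbTE mc) mul0r.
Qed.

Lemma weight3E i j c (w : I -> R) : j != i -> c != i -> c != j ->
  (forall m, m \notin [set i; j; c]%SET -> w m = 0) -> w =1 weight3 i j c (w i) (w j) (w c).
Proof.
move=> ji ci cj w0 m; rewrite /weight3.
case: eqP => [->//|/eqP mi]; case: eqP => [->//|/eqP mj]; case: eqP => [->//|/eqP mc].
by apply: w0; rewrite !inE !negb_or mi mj mc.
Qed.

Lemma weight3_notin i j c s t w m : m \notin [set i; j; c]%SET -> weight3 i j c s t w m = 0.
Proof.
by rewrite !inE !negb_or /weight3 => /andP[/andP[/negbTE-> /negbTE->] /negbTE->].
Qed.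

Lemma hull3 i j c x : j != i -> c != i -> c != j ->
  hull [set i; j; c]%SET x <-> exists s t w, [/\ 0 <= s, 0 <= t, 0 <= w, s + t + w = 1 &
    x = (s * (x_ i).1 + t * (x_ j).1 + w * (x_ c).1, s * (x_ i).2 + t * (x_ j).2 + w * (x_ c).2)].
Proof.
move=> ji ci cj; split.
  move=> [w [w0 wK w1 ->]]; exists (w i), (w j), (w c).
  have E := weight3E ji ci cj wK.
  have E1 f : \sum_m w m * f m = w i * f i + w j * f j + w c * f c.
    by rewrite -sum_weight3 //; apply: eq_bigr => m _; rewrite -E.
  split => //; last by rewrite !E1.
  by have := E1 (fun=> 1); under eq_bigr do rewrite mulr1; rewrite !mulr1 w1 => <-.
move=> [s [t [w [s0 t0 w0 stw ->]]]]; exists (weight3 i j c s t w); split.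
- by move=> m; rewrite /weight3; do ?case: ifP.
- by move=> m; apply: weight3_notin.
- have := sum_weight3 s t w (fun=> 1) ji ci cj; under eq_bigr do rewrite mulr1.
  by rewrite !mulr1 stw.
- by rewrite !sum_weight3.
Qed.

(** The zero weight at [c] is kept so that [bary_combination] applies and shows that points of the
    edge have no component at [c]. *)
Lemma hull2 i j c x : j != i -> c != i -> c != j -> hull [set i; j]%SET x ->
  exists s t, s + t + 0 = 1 /\
    x = (s * (x_ i).1 + t * (x_ j).1 + 0 * (x_ c).1, s * (x_ i).2 + t * (x_ j).2 + 0 * (x_ c).2).
Proof.
move=> ji ci cj [w [w0 wK w1 ->]]; exists (w i), (w j).
have wc : w c = 0 by apply: wK; rewrite !inE (negbTE ci) (negbTE cj).
have wK3 m : m \notin [set i; j; c]%SET -> w m = 0.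
  by move=> mK; apply: wK; apply: contra mK; rewrite !inE => /orP[] ->; rewrite ?orbT.
have E := weight3E ji ci cj wK3; rewrite wc in E.
have E1 f : \sum_m w m * f m = w i * f i + w j * f j + 0 * f c.
  by rewrite -sum_weight3 //; apply: eq_bigr => m _; rewrite -E.
split; last by rewrite !E1.
by have := E1 (fun=> 1); under eq_bigr do rewrite mulr1; rewrite !mulr1 w1 => <-.
Qed.

(** If the determinant vanishes, its entries are the coefficients of linear relations between the
    two edge vectors at [c]. Independence makes all entries zero, and then the coefficients 1 and 0
    give a relation too. *)
Lemma area_neq0 i j c : j != i -> c != i -> c != j -> affine_indep [set i; j; c]%SET ->
  area (x_ c) (x_ j) (x_ i) != 0.
Proof.
move=> ji ci cj aff; apply/negP => /eqP D0.
have key s t : s * ((x_ i).1 - (x_ c).1) + t * ((x_ j).1 - (x_ c).1) = 0 ->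
    s * ((x_ i).2 - (x_ c).2) + t * ((x_ j).2 - (x_ c).2) = 0 -> s = 0 /\ t = 0.
  move=> H1 H2.
  have := aff (weight3 i j c s t (- (s + t))) (@weight3_notin _ _ _ _ _ _).
  have := sum_weight3 s t (- (s + t)) (fun=> 1) ji ci cj.
  under eq_bigr do rewrite mulr1.
  rewrite !mulr1 subrr => -> /(_ erefl); rewrite !sum_weight3 //.
  have E (u v w : R) : s * u + t * v + - (s + t) * w = s * (u - w) + t * (v - w) by ring.
  rewrite !E => /(_ H1 H2) H; have := H i; have := H j.
  by rewrite /weight3 !eqxx (negbTE ji).
move: D0; rewrite /area => D0.
have [||v1 u1] := key ((x_ j).1 - (x_ c).1) (- ((x_ i).1 - (x_ c).1)); first by ring.
  by rewrite -[RHS]oppr0 -[X in _ = - X]D0; ring.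
have [||v2 u2] := key ((x_ j).2 - (x_ c).2) (- ((x_ i).2 - (x_ c).2)).
- by rewrite -[RHS]D0; ring.
- by ring.
have [||/eqP] := key 1 0; last by rewrite oner_eq0.
- by move/eqP: u1; rewrite oppr_eq0 => /eqP ->; ring.
- by move/eqP: u2; rewrite oppr_eq0 => /eqP ->; ring.
Qed.

Lemma hull_triangle i j c : j != i -> c != i -> c != j ->
  area (x_ c) (x_ j) (x_ i) != 0 -> hull [set i; j; c]%SET = triangle (x_ c) (x_ i) (x_ j).
Proof.
move=> ji ci cj D0; apply/seteqP; split => x.
  move=> /hull3 -/(_ ji ci cj) [s [t [w [s0 t0 w0 stw E]]]].
  have [A B] := bary_combination D0 stw E.
  split; rewrite ?A ?B // !(pevalD, pevalN) peval1 A B; lra.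
move=> [A0 B0 C0]; apply/hull3 => //.
do 3 eexists; split; [exact: A0|exact: B0|exact: C0| |exact: triangle_combination].
by rewrite pevalD pevalN pevalD peval1; ring.
Qed.

Lemma area_cycle (a b p : R * R) : area a b p = - area p b a.
Proof. by rewrite /area; ring. Qed.

Section Conforming.
Hypothesis Kok : forall K, K \in elts M -> #|K| = 3%N /\ affine_indep K.
Hypothesis conf : forall K K', K \in elts M -> K' \in elts M ->
  hull K `&` hull K' = hull (K :&: K').

Lemma elt_opposite K i j : K \in elts M -> i \in K -> j \in K -> i != j ->
  exists c, [/\ K = [set i; j; c]%SET, c != i, c != j & area (x_ c) (x_ j) (x_ i) != 0].
Proof.
move=> /Kok[K3 aff] iK jK ij; have [c [E ci cj]] := elt_vertices K3 iK jK ij.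
exists c; split => //; apply: area_neq0 => //; first by rewrite eq_sym.
by rewrite -E.
Qed.

(* Otherwise the point [z], close to the midpoint of the common edge, lies in both
   elements but not on the edge. *)
Lemma opposite_sides i j c c' : i != j ->
  [set i; j; c]%SET \in elts M -> [set i; j; c']%SET \in elts M ->
  c != i -> c != j -> c' != i -> c' != j -> c != c' ->
  area (x_ i) (x_ j) (x_ c) * area (x_ i) (x_ j) (x_ c') < 0.
Proof.
move=> ij KM KM' ci cj ci' cj' cc'; have ji : j != i by rewrite eq_sym.
have D0 : area (x_ c) (x_ j) (x_ i) != 0 by apply: area_neq0 => //; apply: (Kok KM).2.
have D0' : area (x_ c') (x_ j) (x_ i) != 0 by apply: area_neq0 => //; apply: (Kok KM').2.
rewrite ![area (x_ i) _ _]area_cycle mulrNN ltNge; apply/negP => pos.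
set A := peval (bary (x_ c) (x_ j) (x_ i)) (x_ c').
set B := peval (bary (x_ c) (x_ i) (x_ j)) (x_ c').
have C0 : 0 < 1 - (A + B).
  have -> : 1 - (A + B) = area (x_ c') (x_ j) (x_ i) / area (x_ c) (x_ j) (x_ i).
    rewrite /A /B !peval_bary [area (x_ c) (x_ i) (x_ j)]areaC.
    by move: D0; rewrite /area => H; field; exact: H.
  rewrite -[_ / _]mulr1 -(divff D0) mulf_div divr_gt0 //.
    by rewrite lt_neqAle mulrC pos andbT eq_sym mulf_neq0.
  by rewrite -expr2 lt_neqAle sqr_ge0 andbT eq_sym expf_neq0.
(* The point z moves from the midpoint towards [x_ c'] by a fraction e. With e = 1 / (2 m), its
   coordinates (1 - e) / 2 + e A and (1 - e) / 2 + e B in the first element stay nonnegative. *)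
pose m := 1 + `|A| + `|B|.
have m0 : 0 < m by rewrite /m -addrA ltr_pwDl // addr_ge0.
pose e := (2 * m)^-1.
have e0 : 0 < e by rewrite invr_gt0 mulr_gt0.
have em : e * m = 2^-1 by rewrite /e; field; rewrite lt0r_neq0.
have eA : `|e * A| = e * `|A| by rewrite normrM gtr0_norm.
have eB : `|e * B| = e * `|B| by rewrite normrM gtr0_norm.
have eA0 : 0 <= e * `|A| by rewrite mulr_ge0 // ltW.
have eB0 : 0 <= e * `|B| by rewrite mulr_ge0 // ltW.
have Em : e + e * `|A| + e * `|B| = 2^-1 by rewrite -em /m; ring.
have := ler_norm (- (e * A)); have := ler_norm (- (e * B)).
rewrite !normrN eA eB => nB nA.
have eC : 0 < e * (1 - (A + B)) by rewrite mulr_gt0.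
pose z : R * R := ((1 - e) / 2 * (x_ i).1 + (1 - e) / 2 * (x_ j).1 + e * (x_ c').1,
  (1 - e) / 2 * (x_ i).2 + (1 - e) / 2 * (x_ j).2 + e * (x_ c').2).
have zE : z = (((1 - e) / 2 + e * A) * (x_ i).1 + ((1 - e) / 2 + e * B) * (x_ j).1 +
    e * (1 - (A + B)) * (x_ c).1,
  ((1 - e) / 2 + e * A) * (x_ i).2 + ((1 - e) / 2 + e * B) * (x_ j).2 +
    e * (1 - (A + B)) * (x_ c).2).
  rewrite /z; have := triangle_combination D0 (x_ c').
  rewrite pevalD pevalN pevalD peval1 -/A -/B; case: (x_ c') => u v [-> ->] /=.
  by congr (_, _); ring.
have zK : hull [set i; j; c]%SET z.
  apply/hull3 => //; do 3 eexists; split; last exact: zE; [lra|lra|lra|by field].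
have zK' : hull [set i; j; c']%SET z.
  apply/hull3 => //; exists ((1 - e) / 2), ((1 - e) / 2), e; split => //; [lra|lra|lra|by field].
have KK : [set i; j; c]%SET :&: [set i; j; c']%SET = [set i; j]%SET.
  apply/setP => n; rewrite !inE.
  case: (eqVneq n i) => //= ni; case: (eqVneq n j) => //= nj.
  by case: (eqVneq n c) => //= ->; apply/negbTE.
have : hull [set i; j]%SET z by rewrite -KK -conf.
move=> /(hull2 ji ci cj)[s [t [st zE']]].
have [A1 B1] := bary_combination D0 st zE'.
have [|A2 B2] := bary_combination D0 _ zE; first by field.
by move: A2 B2; rewrite A1 B1 => A2 B2; move: st; rewrite A2 B2; lra.
Qed.

End Conforming.
End MeshGeometry.

(** * Exposed edges of a set of elements, and integrals over an element *)

Section MeshElements.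
Context {R : realType} (M : mesh R).
Local Notation I := 'I_(nnode M).
Local Notation x_ := (@node R M).
Implicit Types (i j c : I) (K : {set I}) (e : I * I) (p : poly2 R).
Hypothesis Kok : forall K, K \in elts M -> #|K| = 3%N /\ affine_indep K.
Hypothesis conf : forall K K', K \in elts M -> K' \in elts M ->
  hull K `&` hull K' = hull (K :&: K').

Lemma finite_max (T : finType) (A : {set T}) (f : T -> R) : A != finset.set0 ->
  exists2 x, x \in A & forall y, y \in A -> f y <= f x.
Proof.
move=> /set0Pn[x0 x0A].
have := @Order.TotalTheory.arg_maxP _ R T x0 (mem A) f x0A.
by case=> x xA H; exists x.
Qed.

(* [i] is a vertex farthest from the origin, so that all other vertices lie
   strictly in a half-plane through [x_ i]; [j] is the neighbour of [i] seen in the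
   extremal direction.  All elements of [S] with edge [i j] then lie on the same
   side of it. *)
Lemma exposed_edge (S : {set {set I}}) : S \subset elts M -> S != finset.set0 ->
  exists K i j, [/\ K \in S, i \in K, j \in K, i != j &
    forall K', K' \in S -> i \in K' -> j \in K' -> K' = K].
Proof.
move=> SM S0; have SE K : K \in S -> K \in elts M by move/(fintype.subsetP SM).
pose V := finset.cover S.
have VP m : m \in V -> exists2 K, K \in S & m \in K by move=> /bigcupP[K]; exists K.
have PV m K : K \in S -> m \in K -> m \in V by move=> KS mK; apply/bigcupP; exists K.
have V0 : V != finset.set0.
  have /set0Pn[K KS] := S0; have [K3 _] := Kok (SE _ KS).
  have /set0Pn[m mK] : K != finset.set0 by rewrite -card_gt0 K3.
  by apply/set0Pn; exists m; apply: PV mK.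
have [i iV imax] := finite_max (fun m => (x_ m).1 ^+ 2 + (x_ m).2 ^+ 2) V0.
set X := x_ i in imax.
(* Up to the factor |X|, [h] is the depth behind the tangent at X to the circle about the origin,
   and [k] is the coordinate along this tangent. Hence [k / h] orders the directions seen from X. *)
pose h m := - (X.1 * ((x_ m).1 - X.1) + X.2 * ((x_ m).2 - X.2)).
pose k m := X.1 * ((x_ m).2 - X.2) - X.2 * ((x_ m).1 - X.1).
have oppK K j : K \in S -> i \in K -> j \in K -> j != i ->
    exists c, [/\ K = [set i; j; c]%SET, c != i, c != j & area (x_ c) (x_ j) X != 0].
  by move=> KS iK jK ji; apply: elt_opposite => //; [exact: SE|rewrite eq_sym].
pose W := [set m | (m != i) && [exists K in S, (i \in K) && (m \in K)]]%SET.
have WP m : m \in W -> m != i /\ exists K, [/\ K \in S, i \in K & m \in K].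
  by rewrite inE => /andP[mi /existsP[K /and3P[KS iK mK]]]; split => //; exists K.
have PW m K : K \in S -> i \in K -> m \in K -> m != i -> m \in W.
  by move=> KS iK mK mi; rewrite inE mi; apply/existsP; exists K; rewrite KS iK.
have hpos m : m \in W -> 0 < h m.
  move=> /WP[mi [K [KS iK mK]]].
  have [c [_ _ _ D0]] := oppK _ _ KS iK mK mi.
  have := imax _ (PV _ _ KS mK).
  have neq : 0 < ((x_ m).1 - X.1) ^+ 2 + ((x_ m).2 - X.2) ^+ 2.
    rewrite lt_neqAle addr_ge0 ?sqr_ge0 // andbT eq_sym.
    apply: contra D0; rewrite paddr_eq0 ?sqr_ge0 // !sqrf_eq0 !subr_eq0 => /andP[/eqP E1 /eqP E2].
    by rewrite /area E1 E2; apply/eqP; ring.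
  (* Expanding |x_m|^2 <= |X|^2 about X gives |x_m - X|^2 <= 2 h(m). *)
  by rewrite /h; nra.
have W0 : W != finset.set0.
  have [K KS iK] := VP _ iV; have [K3 _] := Kok (SE _ KS).
  have : (1 < #|K|)%N by rewrite K3.
  move=> /card_gt1P[m [n [mK nK mn]]]; apply/set0Pn.
  case: (eqVneq m i) => [mi|mi]; last by exists m; apply: PW mK mi.
  by exists n; apply: PW nK _ => //; rewrite -mi eq_sym.
have [j jW jmax] := finite_max (fun m => k m / h m) W0.
have [ji [K [KS iK jK]]] := WP _ jW.
exists K, i, j; split => //; first by rewrite eq_sym.
have X0 : 0 < X.1 ^+ 2 + X.2 ^+ 2.
  have hj := hpos _ jW; rewrite lt_neqAle addr_ge0 ?sqr_ge0 // andbT eq_sym.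
  apply: contraTN hj; rewrite paddr_eq0 ?sqr_ge0 // !sqrf_eq0 => /andP[/eqP E1 /eqP E2].
  by rewrite /h E1 E2 !mul0r addr0 oppr0 ltxx.
have side K1 c : K1 \in S -> K1 = [set i; j; c]%SET -> c != i -> c != j ->
    area (x_ c) (x_ j) X != 0 -> area X (x_ j) (x_ c) < 0.
  move=> K1S E ci cj D0; rewrite lt_neqAle area_cycle oppr_eq0 D0 /= oppr_le0.
  have cW : c \in W by apply: (PW _ K1) => //; rewrite E !inE eqxx ?orbT.
  have := jmax _ cW; rewrite ler_pdivrMr ?hpos // mulrAC ler_pdivlMr ?hpos //.
  (* Maximality of [k / h] at [j] makes the right side nonnegative, which fixes the side on which
     the opposite vertex lies. *)
  have E2 : area (x_ c) (x_ j) X * (X.1 ^+ 2 + X.2 ^+ 2) = k j * h c - k c * h j.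
    by rewrite /area /k /h; ring.
  by move=> H; rewrite -(pmulr_lge0 _ X0) E2 subr_ge0.
move=> K' K'S iK' jK'.
have [c [E ci cj D0]] := oppK _ _ KS iK jK ji.
have [c' [E' ci' cj' D0']] := oppK _ _ K'S iK' jK' ji.
case: (eqVneq c c') => [cc|cc]; first by rewrite E E' cc.
have ij : i != j by rewrite eq_sym.
have KM := SE _ KS; have KM' := SE _ K'S; rewrite E in KM; rewrite E' in KM'.
have := opposite_sides Kok conf ij KM KM' ci cj ci' cj' cc.
by rewrite ltNge ltW // nmulr_rgt0 ?(side K c) ?(side K' c').
Qed.

Lemma elt_hull K : K \in elts M -> exists C (x0 : R * R),
  [/\ measurable (hull K), hull K `<=` box C & nbhs x0 (hull K)].
Proof.
move=> KM; have [K3 _] := Kok KM.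
have /card_gt1P[i [j [iK jK ij]]] : (1 < #|K|)%N by rewrite K3.
have [c [-> ci cj D0]] := elt_opposite Kok KM iK jK ij.
rewrite hull_triangle //; last by rewrite eq_sym.
have [C HC] := triangle_bounded D0; have [x0 Hx0] := triangle_interior D0.
by exists C, x0; split => //; apply: measurable_triangle.
Qed.

Lemma intKD K p q : K \in elts M -> intK K (p + q) = intK K p + intK K q.
Proof.
move=> /elt_hull[C [x0 [mK KC _]]]; rewrite /intK.
under eq_Rintegral do rewrite pevalD.
by apply: RintegralD => //; apply: integrable_peval KC.
Qed.

Lemma intKN K p : K \in elts M -> intK K (- p) = - intK K p.
Proof.
move=> KM; apply/eqP; rewrite -addr_eq0 -intKD // addNr /intK.
under eq_Rintegral do rewrite peval0.
by rewrite Rintegral_cst ?mul0r //; have [C [x0 []]] := elt_hull KM.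
Qed.

Lemma intK0 K : K \in elts M -> intK K 0 = 0.
Proof. by move=> KM; rewrite -(subrr 0) intKD // intKN // subrr. Qed.

Lemma intK_ge0 K p : (forall x, 0 <= peval p x) -> 0 <= intK K p.
Proof. by move=> p0; apply: Rintegral_ge0. Qed.

Lemma intK_eq0 K p : K \in elts M -> (forall x, 0 <= peval p x) -> intK K p = 0 -> p = 0.
Proof. by move=> /elt_hull[C [x0 [mK KC nK]]]; exact: (Rintegral_peval_eq0 mK KC nK). Qed.

End MeshElements.

(** * Jumps across edges *)

Section MeshEdges.
Context {R : realType} (M : mesh R).
Local Notation I := 'I_(nnode M).
Local Notation x_ := (@node R M).
Implicit Types (i j c : I) (K : {set I}) (e : I * I) (p : poly2 R) (q : {poly R}).
Hypothesis Kok : forall K, K \in elts M -> #|K| = 3%N /\ affine_indep K.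
Hypothesis conf : forall K K', K \in elts M -> K' \in elts M ->
  hull K `&` hull K' = hull (K :&: K').

Lemma edge_elt e K : K \in elts M -> edge_of e K ->
  exists c, [/\ K = [set e.1; e.2; c]%SET, e.1 != e.2, c != e.1, c != e.2 &
    area (x_ c) (x_ e.2) (x_ e.1) != 0].
Proof.
move=> KM /and3P[lt12 e1K e2K].
have e12 : e.1 != e.2 by rewrite -val_eqE /= neq_ltn lt12.
by have [c [? ? ? ?]] := elt_opposite Kok KM e1K e2K e12; exists c.
Qed.

Lemma dotv_rot (n : 'cV[R]_2) (L : R) : dotv n (L *: rot n) = 0.
Proof. by rewrite /dotv sum_ord2 !mxE /=; ring. Qed.

Lemma dotvN (n u v : 'cV[R]_2) : dotv n (u - v) = - dotv n (v - u).
Proof. by rewrite /dotv !sum_ord2 !mxE; ring. Qed.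

Lemma edge_frame e K : K \in elts M -> edge_of e K ->
  [/\ 0 < edge_len e, vec (x_ e.2) - vec (x_ e.1) = edge_len e *: rot (edge_normal e) &
      edge_normal e ord0 0 ^+ 2 + edge_normal e ord_max 0 ^+ 2 = 1].
Proof.
move=> KM eK; have [c [_ _ _ _ D0]] := edge_elt KM eK.
set v := edge_vec e; set L := edge_len e.
have v0 (i : 'I_2) : v i 0 = vec (x_ e.2) i 0 - vec (x_ e.1) i 0 by rewrite /v /edge_vec !mxE.
have vv : 0 < v ord0 0 ^+ 2 + v ord_max 0 ^+ 2.
  rewrite lt_neqAle addr_ge0 ?sqr_ge0 // andbT eq_sym; apply: contra D0.
  rewrite paddr_eq0 ?sqr_ge0 // !sqrf_eq0 !v0 !vec0 !vec1 !subr_eq0 => /andP[/eqP E1 /eqP E2].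
  by rewrite /area E1 E2; apply/eqP; ring.
have LE : L = Num.sqrt (v ord0 0 ^+ 2 + v ord_max 0 ^+ 2).
  by rewrite /L /edge_len /dotv sum_ord2 -!expr2.
have L0 : 0 < L by rewrite LE sqrtr_gt0.
have LL : L ^+ 2 = v ord0 0 ^+ 2 + v ord_max 0 ^+ 2 by rewrite LE sqr_sqrtr // ltW.
have n0 : edge_normal e ord0 0 = L^-1 * v ord_max 0.
  by rewrite /edge_normal [LHS]mxE rot0 opprK mxE.
have n1 : edge_normal e ord_max 0 = - (L^-1 * v ord0 0).
  by rewrite /edge_normal [LHS]mxE rot1 mxE.
split => //.
  apply/colP => i; rewrite [RHS]mxE -[LHS]/(v i 0).
  case: (ord2P i) => ->; rewrite ?rot0 ?rot1 ?n0 ?n1 ?opprK mulrA mulfV ?mul1r //;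
  by rewrite lt0r_neq0.
by rewrite n0 n1 sqrrN !exprMn -mulrDr addrC -LL exprVn mulVf // expf_neq0 // lt0r_neq0.
Qed.

(** By definition [out_normal K e] is [- side K e *: edge_normal e]. For an edge of an element the
    value is 1 or -1, according to the side on which the element lies. *)
Definition side K e : R :=
  Num.sg (\sum_(c in K) dotv (edge_normal e) (vec (x_ c) - vec (x_ e.1))).

Lemma sideE e K c : K \in elts M -> edge_of e K -> K = [set e.1; e.2; c]%SET ->
  e.1 != e.2 -> c != e.1 -> c != e.2 ->
  side K e = Num.sg (area (x_ e.1) (x_ e.2) (x_ c)).
Proof.
move=> KM eK E e12 ce1 ce2; have [L0 eL nn] := edge_frame KM eK.
rewrite /side (bigD1 c) /=; last by rewrite E !inE eqxx orbT.
rewrite big1 ?addr0 => [|m /andP[]]; last first.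
  rewrite E !inE => /orP[/orP[]|] /eqP -> mc; last by rewrite eqxx in mc.
    by rewrite subrr /dotv big1 // => i _; rewrite !mxE mulr0.
  by rewrite eL dotv_rot.
by rewrite area_cycle (area_normal_offset _ eL) -mulrN -dotvN [RHS]sgrM (gtr0_sg L0) mul1r.
Qed.

Lemma side_sqr e K : K \in elts M -> edge_of e K -> side K e * side K e = 1.
Proof.
move=> KM eK; have [c [E e12 ce1 ce2 D0]] := edge_elt KM eK.
rewrite (sideE KM eK E) // -expr2 sqr_sg area_cycle oppr_eq0.
by rewrite area_cycle area_cycle !oppr_eq0 in D0 *; rewrite D0.
Qed.

Lemma side_opposite e K K' : K \in elts M -> K' \in elts M -> edge_of e K -> edge_of e K' ->
  K != K' -> side K e * side K' e = -1.
Proof.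
move=> KM KM' eK eK' KK'.
have [c [E e12 ce1 ce2 _]] := edge_elt KM eK.
have [c' [E' _ ce1' ce2' _]] := edge_elt KM' eK'.
rewrite (sideE KM eK E) // (sideE KM' eK' E') // -sgrM ltr0_sg //.
apply: opposite_sides => //; [by rewrite -E|by rewrite -E'|].
by apply: contra KK' => /eqP cc; rewrite E E' cc.
Qed.

(** Three different elements at one edge would have pairwise opposite signs [side], which is
    impossible for three numbers equal to 1 or -1. *)
Lemma edge_two_elts e K K' K'' : K \in elts M -> K' \in elts M -> K'' \in elts M ->
  edge_of e K -> edge_of e K' -> edge_of e K'' -> K != K' -> K'' = K \/ K'' = K'.
Proof.
move=> KM KM' KM'' eK eK' eK'' KK'.
case: (eqVneq K'' K) => [|nK]; first by left.
case: (eqVneq K'' K') => [|nK']; first by right.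
have s0 := side_opposite KM KM' eK eK' KK'.
have s1 := side_opposite KM'' KM eK'' eK nK.
have s2 := side_opposite KM'' KM' eK'' eK' nK'.
have s3 := side_sqr KM'' eK''.
have : side K e * side K' e = 1.
  by rewrite -[LHS]mul1r -[X in X * _]s3 mulrACA s1 s2; ring.
by rewrite s0 => ?; exfalso; lra.
Qed.

Lemma sum_edge_elts e K K' (F : {set I} -> R) : K \in elts M -> K' \in elts M ->
  edge_of e K -> edge_of e K' -> K != K' ->
  \sum_(K'' in elts M | edge_of e K'') F K'' = F K + F K'.
Proof.
move=> KM KM' eK eK' KK'.
rewrite (bigD1 K) /=; last by rewrite KM.
rewrite (bigD1 K') /=; last by rewrite KM' eK' eq_sym.
rewrite big1 ?addr0 // => K'' /andP[/andP[/andP[KM'' eK''] nK] nK'].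
by case: (edge_two_elts KM KM' KM'' eK eK' eK'' KK') => E; rewrite E eqxx in nK nK'.
Qed.

Lemma edge_ipE e p q : edge_ip e p q = edge_len e *
  \int[@lebesgue_measure R]_(s in `[0, 1]%classic) ((restr (x_ e.1) (x_ e.2) p) * q).[s].
Proof.
by congr (_ * _); apply: eq_Rintegral => s _; rewrite hornerM restrE.
Qed.

Lemma edge_ip_ext e p p' q :
  restr (x_ e.1) (x_ e.2) p = restr (x_ e.1) (x_ e.2) p' -> edge_ip e p q = edge_ip e p' q.
Proof. by rewrite !edge_ipE => ->. Qed.

Lemma edge_ip0 e p : edge_ip e p 0 = 0.
Proof.
rewrite edge_ipE mulr0; under eq_Rintegral do rewrite horner0.
by rewrite Rintegral_cst ?mul0r ?mulr0.
Qed.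

Lemma edge_ipN e p q : edge_ip e (- p) q = - edge_ip e p q.
Proof.
rewrite !edge_ipE rmorphN mulNr -[RHS]mulrN; congr (_ * _).
set P := _ * q; have iP : (@lebesgue_measure R).-integrable `[0, 1]%classic (EFin \o horner P).
  apply: continuous_compact_integrable; first exact: segment_compact.
  by apply: continuous_subspaceT => s; exact: continuous_horner.
rewrite -[RHS]mulN1r -RintegralZl //.
by apply: eq_Rintegral => s _; rewrite hornerN mulN1r.
Qed.

Lemma edge_ip_out e K tau q : K \in elts M -> edge_of e K ->
  edge_ip e (tr3 (out_normal K e) tau) q = - side K e * edge_ip e (tr3 (edge_normal e) tau) q.
Proof.
move=> KM eK; rewrite /out_normal -/(side K e).
have : (side K e - 1) * (side K e + 1) = 0.
  by rewrite -subr_sqr expr1n expr2 side_sqr // subrr.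
move/eqP; rewrite mulf_eq0 subr_eq0 addr_eq0 => /orP[] /eqP ->.
  by rewrite scaleN1r tr3N edge_ipN mulN1r.
by rewrite opprK scale1r mul1r.
Qed.

Lemma sum_single (T : finType) (f : T -> R) (t : T) :
  (forall t', t' != t -> f t' = 0) -> \sum_t' f t' = f t.
Proof. by move=> f0; rewrite (bigD1 t) //= big1 ?addr0. Qed.

Local Opaque edge_ip tr3 side.

Definition jump (tau : btens M) (mu : eskel M) : R :=
  \sum_(K in elts M) \sum_(e | edge_of e K) edge_ip e (tr3 (out_normal K e) (tau K)) (mu e).

Lemma jumpE tau mu : jump tau mu =
  \sum_e \sum_(K in elts M | edge_of e K)
    (- side K e * edge_ip e (tr3 (edge_normal e) (tau K)) (mu e)).
Proof.
rewrite /jump (exchange_big_dep predT) //=; apply: eq_bigr => e _.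
by apply: eq_bigr => K /andP[KM eK]; exact: edge_ip_out.
Qed.

Lemma jump0 tau : jump tau (fun=> 0) = 0.
Proof. by rewrite /jump big1 // => K _; rewrite big1 // => e _; rewrite edge_ip0. Qed.

(** A multiplier equal to [q] on [e] and zero elsewhere is admissible, because an edge of two
    different elements is interior. As these lie on opposite sides, the jump is, up to sign, the
    difference of the two moments. *)
Lemma S3_single_of_jump l tau :
  (forall mu, Lambda_h l mu -> jump tau mu = 0) -> S3_single l tau.
Proof.
move=> J0 e K K' KM KM' eK eK' q ql.
case: (eqVneq K K') => [->//|KK'].
pose mu e' : {poly R} := if e' == e then q else 0.
have muL : Lambda_h l mu.
  split => e'; rewrite /mu.
    by case: (eqVneq e' e) => // _ _; rewrite /deg1_le size_poly0.
  case: (eqVneq e' e) => // -> _ /negP[].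
  apply/existsP; exists K; rewrite KM; apply/existsP; exists K'.
  by rewrite KM' KK' eK.
have F0 e' : e' != e -> \sum_(K1 in elts M | edge_of e' K1)
    (- side K1 e' * edge_ip e' (tr3 (edge_normal e') (tau K1)) (mu e')) = 0.
  by move=> ne; apply: big1 => K1 _; rewrite /mu (negbTE ne) edge_ip0 mulr0.
have := J0 _ muL; rewrite jumpE (sum_single F0).
rewrite (sum_edge_elts _ KM KM' eK eK' KK') /mu eqxx.
move: (edge_ip e (tr3 (edge_normal e) (tau K)) q) => u.
move: (edge_ip e (tr3 (edge_normal e) (tau K')) q) => v.
have s1 := side_sqr KM eK; have s2 := side_opposite KM KM' eK eK' KK'.
move=> /(congr1 ( *%R (side K e))); rewrite mulr0 mulrDr !mulrA !mulrN s1 s2.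
by rewrite opprK mul1r mulN1r => /eqP; rewrite addrC subr_eq0 => /eqP.
Qed.

Lemma jump_S3_single l tau mu : S3_single l tau -> Lambda_h l mu -> jump tau mu = 0.
Proof.
move=> S3 [mui mub]; rewrite jumpE big1 // => e _.
case: (boolP (@is_iedge R M e)) => [ie|nie].
  have /existsP[K /andP[KM /existsP[K' /andP[KM' /and3P[KK' eK eK']]]]] := ie.
  rewrite (sum_edge_elts _ KM KM' eK eK' KK') (S3 e K K' KM KM' eK eK' _ (mui e ie)).
  move: (edge_ip _ _ _) => u.
  have s1 := side_sqr KM eK; have s2 := side_opposite KM KM' eK eK' KK'.
  have -> : side K' e = - side K e by rewrite -[LHS]mul1r -[X in X * _]s1 -mulrA s2; ring.
  ring.
rewrite big1 // => K /andP[KM eK]; rewrite mub ?edge_ip0 ?mulr0 //.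
by apply/existsP; exists K; rewrite KM.
Qed.

End MeshEdges.

(** * Uniqueness of the displacement *)

Section Uniqueness.
Context {R : realType} (M : mesh R).
Local Notation I := 'I_(nnode M).
Local Notation x_ := (@node R M).
Implicit Types (i j c : I) (K : {set I}) (e : I * I) (tau : 'M[poly2 R]_2).
Variables (org : {set I} -> R * R) (k l : nat).
Hypothesis Kok : forall K, K \in elts M -> #|K| = 3%N /\ affine_indep K.
Hypothesis conf : forall K K', K \in elts M -> K' \in elts M ->
  hull K `&` hull K' = hull (K :&: K').
Hypotheses (k3 : (3 <= k)%N) (kl : (k - 1 <= l)%N).

Definition S2_trace e tau : {poly R} :=
  restr (x_ e.1) (x_ e.2) (bilin (edge_normal e) (edge_normal e) tau).
Definition S3_trace e tau : {poly R} := restr (x_ e.1) (x_ e.2) (tr3 (edge_normal e) tau).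

Lemma S2_trace0 e : S2_trace e 0 = 0.
Proof.
rewrite /S2_trace (_ : bilin _ _ 0 = 0) ?rmorph0 //.
by apply: (addrI (bilin (edge_normal e) (edge_normal e) 0)); rewrite -bilinD !addr0.
Qed.

Lemma S3_trace0 e : S3_trace e 0 = 0.
Proof.
rewrite /S3_trace (_ : tr3 _ 0 = 0) ?rmorph0 //.
by apply: (addrI (tr3 (edge_normal e) 0)); rewrite -tr3D !addr0.
Qed.

Lemma peval_bilin0 (u w : 'cV[R]_2) tau (x : R * R) :
  map_mx (peval^~ x) tau = 0 -> peval (bilin u w tau) x = 0.
Proof.
move=> /matrixP t0; have t (a b : 'I_2) : peval (tau a b) x = 0.
  by have := t0 a b; rewrite [LHS]mxE [RHS]mxE.
by rewrite bilinE !(pevalD, pevalM) !t; ring.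
Qed.

Lemma elt_tens_other_edge K e e' c q psi : K \in elts M -> edge_of e K -> edge_of e' K -> e' != e ->
  K = [set e.1; e.2; c]%SET -> area (x_ c) (x_ e.2) (x_ e.1) != 0 ->
  S2_trace e' (elt_tens (x_ c) (x_ e.1) (x_ e.2) q psi) = 0 /\
  S3_trace e' (elt_tens (x_ c) (x_ e.1) (x_ e.2) q psi) = 0.
Proof.
move=> KM eK e'K ne E D0; have [L0 eL nn] := edge_frame Kok KM e'K.
have main a b : area (x_ c) (x_ b) (x_ a) != 0 -> (e' = (c, a)) \/ (e' = (a, c)) ->
    S2_trace e' (elt_tens (x_ c) (x_ a) (x_ b) q psi) = 0 /\
    S3_trace e' (elt_tens (x_ c) (x_ a) (x_ b) q psi) = 0.
  move=> D1 ee.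
  have na : dotv (edge_normal e') (vec (x_ a) - vec (x_ c)) = 0.
    case: ee eL => -> /= eL; first by rewrite eL dotv_rot.
    by rewrite dotvN eL dotv_rot oppr0.
  have xs s : area (x_ c) (x_ a) (seg (x_ e'.1) (x_ e'.2) s) = 0.
    by case: ee => -> /=; rewrite /area /seg /=; ring.
  by split; apply: poly_ext => s; rewrite restrE horner0;
     have [] := elt_tens_edge q psi D1 na nn (xs s).
case/and3P: eK => lt12 _ _; case/and3P: e'K => lt12' e1K e2K.
have [ee|ee] : (e' = (c, e.1) \/ e' = (e.1, c)) \/ (e' = (c, e.2) \/ e' = (e.2, c)).
  move: e1K e2K ne lt12'; rewrite E !inE; case: (e') => [u v] /=.
  move=> /orP[/orP[]|] /eqP -> /orP[/orP[]|] /eqP -> ne lt; rewrite ?ltnn // in lt; try tauto.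
  - by case: (e) ne => ? ?; rewrite eqxx.
  - by have := ltn_trans lt12 lt; rewrite ltnn.
- exact: main.
- by rewrite elt_tensC; apply: main => //; rewrite areaC oppr_eq0.
Qed.

(** [q] alone determines [divdiv], since the sym curl part contributes nothing. This leaves [psi]
    free to cancel the values at the vertices; of the resulting traces on [e] only the degrees
    matter. *)
Lemma elt_source K e (v : poly2 R) : K \in elts M -> edge_of e K -> deg_le (k - 2) v ->
  exists tau, [/\ Sigma_loc l k (org K) tau, forall i, i \in K -> map_mx (peval^~ (x_ i)) tau = 0,
    divdiv tau = v,
    (size (S2_trace e tau) <= l.+1)%N /\ (size (S3_trace e tau) <= l)%N &
    forall e', edge_of e' K -> e' != e -> S2_trace e' tau = 0 /\ S3_trace e' tau = 0].
Proof.
move=> KM eK vk; have [L0 eL nn] := edge_frame Kok KM eK.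
have [c [E e12 ce1 ce2 D0]] := edge_elt Kok KM eK.
have Ln0 := lt0r_neq0 L0.
have l2 : (2 <= l)%N by apply: leq_trans kl; rewrite leq_subRL // (leq_trans _ k3).
set p := x_ c in D0 *; set a := x_ e.1 in D0 eL *; set b := x_ e.2 in D0 eL *.
have [q qk dq] := divdiv_yy_surj p vk.
(* [al] and [be] are the values that [elt_tens_vertex] demands of [psi] at [a] and [b]; [psi]
   interpolates them and is zero at [p]. *)
pose al (i : 'I_2) := - area p b a * peval q a * (vec a i 0 - vec p i 0).
pose be (i : 'I_2) := - area p a b * peval q b * (vec b i 0 - vec p i 0).
pose psi : 'cV[poly2 R]_2 := \col_i ((al i)%:C * bary p b a + (be i)%:C * bary p a b).
have psiE (i : 'I_2) : psi i 0 = (al i)%:C * bary p b a + (be i)%:C * bary p a b by rewrite mxE.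
have D1 : area p a b != 0 by rewrite areaC oppr_eq0.
have psil (i : 'I_2) : deg_le (l - 1) (psi i 0).
  apply: (@deg_le_trans _ 1); first by rewrite leq_subRL // (leq_trans _ l2).
  by rewrite psiE; apply: deg_leD; exact: deg_leM (deg_leC 0 _) (deg_le_bary _ _ _).
have ql : deg_le (l - 1) q.
  by apply: deg_le_trans qk; rewrite -[2%N]/(1 + 1)%N subnDA leq_sub2r.
exists (elt_tens p a b q psi); split.
- exact: Sigma_loc_elt_tens.
- move=> i; rewrite E !inE => /orP[/orP[]|] /eqP ->.
  + apply: elt_tens_vertex => // i0.
    by rewrite psiE pevalD !pevalM !pevalC !peval_bary divff // area_base mul0r mulr1 mulr0 addr0.
  + rewrite elt_tensC; apply: elt_tens_vertex => // i0.
    by rewrite psiE pevalD !pevalM !pevalC !peval_bary divff // area_base mul0r mulr1 mulr0 add0r.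
  + exact: elt_tens_vertex0.
- by rewrite /elt_tens divdivD divdiv_symcurl add0r.
- exact: (size_elt_data D0 Ln0 nn eL (ltnW l2) ql psil).
- by move=> e' e'K ne; apply: (elt_tens_other_edge (K := K)).
Qed.

(** The counterpart of [elt_source] for the neighbour across [e]. It leaves [divdiv] uncontrolled,
    as it is applied where the test function vanishes. *)
Lemma elt_realize K e (G2 G3 : {poly R}) : K \in elts M -> edge_of e K ->
  (size G2 <= l.+1)%N -> G2.[0] = 0 -> G2.[1] = 0 -> (size G3 <= l)%N ->
  exists tau, [/\ Sigma_loc l k (org K) tau, forall i, i \in K -> map_mx (peval^~ (x_ i)) tau = 0,
    S2_trace e tau = G2 /\ S3_trace e tau = G3 &
    forall e', edge_of e' K -> e' != e -> S2_trace e' tau = 0 /\ S3_trace e' tau = 0].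
Proof.
move=> KM eK sG2 G20 G21 sG3; have [L0 eL nn] := edge_frame Kok KM eK.
have [c [E e12 ce1 ce2 D0]] := edge_elt Kok KM eK.
have l2 : (2 <= l)%N by apply: leq_trans kl; rewrite leq_subRL // (leq_trans _ k3).
have [q [psi [q1 psil ta tb tG]]] := elt_extension D0 (lt0r_neq0 L0) nn eL l2 sG2 G20 G21 sG3.
exists (elt_tens (x_ c) (x_ e.1) (x_ e.2) q psi); split => //.
- apply: Sigma_loc_elt_tens => //; apply: deg_le_trans q1.
  by rewrite leq_subRL // (leq_trans _ k3).
- move=> i; rewrite E !inE => /orP[/orP[]|] /eqP -> //; exact: elt_tens_vertex0.
- by move=> e' e'K ne; apply: (elt_tens_other_edge (K := K)).
Qed.

Lemma divdiv_orthogonal_eq0 (v : bscal M) : Q_h k v ->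
  (forall tau : btens M, Sigma_h l k org tau -> ip_divdiv tau v = 0) ->
  forall K, K \in elts M -> v K = 0.
Proof.
move=> vQ orth; pose S := [set K in elts M | v K != 0]%SET.
suff S0 : S = finset.set0.
  move=> K KM; apply/eqP; apply: contraT => vK.
  have : K \in S by rewrite inE KM vK.
  by rewrite S0 inE.
apply/eqP; apply: contraT => S0.
have SM : S \subset elts M by apply/fintype.subsetP => K; rewrite inE => /andP[].
have [K [i [j [KS iK jK ij Kuniq]]]] := exposed_edge Kok conf SM S0.
have KM : K \in elts M := fintype.subsetP SM _ KS.
have [e [eK eP]] : exists e, edge_of e K /\ forall K', edge_of e K' -> i \in K' /\ j \in K'.
  case: (ltngtP i j) => [lt|lt|/val_inj E]; last by rewrite E eqxx in ij.
  - exists (i, j); rewrite /edge_of /= lt iK jK; by split => // K' /and3P[_ ? ?]; split.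
  - exists (j, i); rewrite /edge_of /= lt iK jK; by split => // K' /and3P[_ ? ?]; split.
have [t [tS tv dt [sG2 sG3] te]] := elt_source KM eK (vQ K KM).
have /and3P[_ e1K e2K] := eK.
have G20 : (S2_trace e t).[0] = 0.
  rewrite /S2_trace restrE; apply: peval_bilin0.
  by rewrite (_ : seg _ _ 0 = x_ e.1) ?tv //; case: (x_ e.1) => u w;
     rewrite /seg /= !mul0r !subr0 !mul1r !addr0.
have G21 : (S2_trace e t).[1] = 0.
  rewrite /S2_trace restrE; apply: peval_bilin0.
  by rewrite (_ : seg _ _ 1 = x_ e.2) ?tv //; case: (x_ e.2) => u w;
     rewrite /seg /= subrr !mul0r !add0r !mul1r.
(* Both traces are prescribed by the edge alone and the vertex values are zero, so comparing two
   elements yields (S1)-(S3) at once. *)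
pose good K' t' := K' \in elts M -> [/\ Sigma_loc l k (org K') t',
    forall m, m \in K' -> map_mx (peval^~ (x_ m)) t' = 0,
    forall e', edge_of e' K' -> (S2_trace e' t', S3_trace e' t') =
      if e' == e then (S2_trace e t, S3_trace e t) else (0, 0),
    K' = K -> t' = t & ~~ edge_of e K' -> t' = 0].
have [tau tauP] : exists tau : btens M, forall K', good K' (tau K').
  suff H K' : exists t', good K' t' by have [tau] := choice H; exists tau.
  case: (eqVneq K' K) => [->|nK].
    exists t => _; split; [exact: tS|exact: tv| |by []|by rewrite eK].
    by move=> e' e'K; case: (eqVneq e' e) => [->//|ne]; have [-> ->] := te e' e'K ne.
  case: (boolP (K' \in elts M)) => [K'M|nM]; last by exists 0 => K'M; rewrite K'M in nM.
  case: (boolP (edge_of e K')) => [eK'|neK'].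
    have [t' [t'S t'v [t'2 t'3] t'e]] := elt_realize K'M eK' sG2 G20 G21 sG3.
    exists t' => _; split; [exact: t'S|exact: t'v| |by move=> E; rewrite E eqxx in nK|
      by rewrite eK'].
    move=> e' e'K; case: (eqVneq e' e) => [->|ne]; first by rewrite t'2 t'3.
    by have [-> ->] := t'e e' e'K ne.
  exists 0 => _; split; [exact: Sigma_loc0| | |by move=> E; rewrite E eqxx in nK|by []].
    by move=> m _; apply: mx2P; rewrite mxE !mxE peval0.
  move=> e' e'K; have -> : (e' == e) = false by apply: contraNF neK' => /eqP <-.
  by rewrite S2_trace0 S3_trace0.
have tauS : Sigma_h l k org tau.
  split; first split.
  - by move=> K' K'M; have [] := tauP K' K'M.
  - move=> m K1 K2 K1M K2M mK1 mK2.
    by have [_ -> // _ _ _] := tauP K1 K1M; have [_ -> //] := tauP K2 K2M.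
  - move=> e' K1 K2 K1M K2M eK1 eK2 q _; apply: edge_ip_ext.
    have [_ _ H1 _ _] := tauP K1 K1M; have [_ _ H2 _ _] := tauP K2 K2M.
    exact: (congr1 fst (etrans (H1 e' eK1) (esym (H2 e' eK2)))).
  - move=> e' K1 K2 K1M K2M eK1 eK2 q _; apply: edge_ip_ext.
    have [_ _ H1 _ _] := tauP K1 K1M; have [_ _ H2 _ _] := tauP K2 K2M.
    exact: (congr1 snd (etrans (H1 e' eK1) (esym (H2 e' eK2)))).
have := orth _ tauS; rewrite /ip_divdiv (bigD1 K) //= big1 ?addr0 => [|K' /andP[K'M nK]].
  have [_ _ _ -> // _] := tauP K KM; rewrite dt => H.
  have : v K * v K = 0.
    apply: (intK_eq0 Kok KM) H => x.
    by rewrite pevalM -expr2 sqr_ge0.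
  by move=> /eqP; rewrite mulf_eq0 orbb => vK; move: KS; rewrite inE vK andbF.
have [_ _ _ _ t0] := tauP K' K'M.
case: (boolP (edge_of e K')) => [eK'|/t0 ->].
  (* The exposed edge enters here: an element of [S] containing [e] can only be [K], so [v] is zero
     on this neighbour. *)
  have : K' \notin S.
    by apply: contra nK => K'S; have [i' j'] := eP _ eK'; apply/eqP; apply: Kuniq.
  by rewrite inE K'M /= negbK => /eqP ->; rewrite mulr0 intK0.
rewrite (_ : divdiv 0 = 0) ?mul0r ?intK0 //.
by rewrite divdivE !mxE !pd0 !addr0 !pd0 addr0.
Qed.

End Uniqueness.

(** * Equivalence of the mixed and the hybridized methods *)

Theorem lemma4p5 (R : realType) (Omega : set (R * R)) (M : mesh R)
    (org : {set 'I_(nnode M)} -> R * R) (k l : nat) (f : R * R -> R)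
    (sigma sigmat : btens M) (u ut : bscal M) (lambda : eskel M) :
  simple_polygon Omega ->
  conforming_triangulation M Omega ->
  (forall K, K \in elts M -> hull K (org K)) ->
  (3 <= k)%N -> (k - 1 <= l)%N ->
  in_L2 Omega f ->
  mixed_solution l k org Omega f sigma u ->
  hybrid_solution l k org Omega f sigmat ut lambda ->
  forall K, K \in elts M -> sigmat K = sigma K /\ ut K = u K.
Proof.
move=> _ [Kok conf _] _ k3 kl _ [sS uQ m1 m2] [stS utQ lamL h1 h2].
have muL0 : Lambda_h (M := M) l (fun=> 0).
  by split => // e _; rewrite /deg1_le size_poly0.
have vQ0 : Q_h (M := M) k (fun=> 0) by move=> K _; apply: deg_le0.
have bE (tau : btens M) v mu : b_h tau v mu = ip_divdiv tau v - jump tau mu by [].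
(* The load of the zero function is not evaluated: the zero multiplier gives the same right-hand
   side, and comparison isolates the jump. *)
have st_jump mu : Lambda_h l mu -> jump sigmat mu = 0.
  move=> muL; have := h2 _ _ vQ0 muL; rewrite -(h2 _ _ vQ0 muL0) !bE jump0 subr0.
  by move/eqP; rewrite -subr_eq0 addrAC subrr add0r oppr_eq0 => /eqP.
have st3 : Sigma_h l k org sigmat.
  by split; [exact: stS|exact: (S3_single_of_jump Kok conf st_jump)].
have h1' tau : Sigma_h l k org tau -> ip_tens sigmat tau + ip_divdiv tau ut = 0.
  move=> tS; rewrite -[RHS](h1 tau tS.1) bE.
  by rewrite (jump_S3_single Kok conf tS.2 lamL) subr0.
have h2' v : Q_h k v -> ip_divdiv sigmat v = ip_divdiv sigma v.
  by move=> vQ; rewrite m2 // -(h2 _ _ vQ muL0) bE jump0 subr0.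
pose d K : 'M[poly2 R]_2 := sigmat K - sigma K.
have dE K i j : d K i j = sigmat K i j - sigma K i j by rewrite mxE [X in _ + X]mxE.
have dd0 : ip_tens d d = 0.
  have -> : ip_tens d d = ip_tens sigmat sigmat - ip_tens sigmat sigma -
      ip_tens sigma sigmat + ip_tens sigma sigma.
    rewrite /ip_tens -!sumrB -big_split /=; apply: eq_bigr => K KM.
    rewrite -!(intKN Kok) // -!(intKD Kok) //; congr intK.
    rewrite !sum_ord2 !dE; ring.
  (* By [h2'] the [divdiv] of [sigmat] and of [sigma] have equal moments against [u] and [ut]. Each
     method tested with both tensors then gives two equal products, and the four terms cancel. *)
  have E1 := m1 _ sS; have E2 := m1 _ st3; have E3 := h1' _ sS; have E4 := h1' _ st3.
  rewrite h2' // in E2; rewrite h2' // in E4; lra.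
have sq0 (p : poly2 R) x : 0 <= peval (p * p) x by rewrite pevalM -expr2 sqr_ge0.
have sqs0 (tau : 'M[poly2 R]_2) x : 0 <= peval (\sum_i \sum_j tau i j * tau i j) x.
  by rewrite !sum_ord2 !(pevalD, pevalM) -!expr2 !addr_ge0 ?sqr_ge0.
have sE K : K \in elts M -> sigmat K = sigma K.
  move=> KM; apply/eqP; rewrite -subr_eq0 -/(d K); apply/eqP.
  have : \sum_i \sum_j d K i j * d K i j = 0.
    apply: (intK_eq0 Kok KM) => //.
    have /psumr_eq0P-> // := dd0 => K' K'M; exact: intK_ge0.
  move=> s0; apply/matrixP => i j; rewrite [RHS]mxE; apply: peval_inj0 => x.
  have := congr1 (peval^~ x) s0; rewrite /= !sum_ord2 !(pevalD, pevalM) peval0 -!expr2 => /eqP.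
  rewrite !paddr_eq0 ?addr_ge0 ?sqr_ge0 // !sqrf_eq0.
  by case/andP => /andP[/eqP ? /eqP ?] /andP[/eqP ? /eqP ?]; case: (ord2P i) => ->; case: (ord2P j) => ->.
move=> K KM; split; first exact: sE.
apply/eqP; rewrite -subr_eq0; apply/eqP.
apply: (divdiv_orthogonal_eq0 (v := fun K => ut K - u K) Kok conf k3 kl _ _ KM).
- by move=> K' K'M; apply: deg_leB; [apply: utQ|apply: uQ].
move=> tau tS; have -> : ip_divdiv tau (fun K => ut K - u K) = ip_divdiv tau ut - ip_divdiv tau u.
  rewrite /ip_divdiv -sumrB; apply: eq_bigr => K' K'M.
  by rewrite -(intKN Kok) // -(intKD Kok) // mulrBr.
have := h1' _ tS; have := m1 _ tS.
have -> : ip_tens sigmat tau = ip_tens sigma tau.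
  by apply: eq_bigr => K' K'M; rewrite sE.
lra.
Qed.
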